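(* Let $\mathcal{A}$ be a locally finite arrangement in $\mathbb{R}^n$. For every generic point $x_0 \in \mathbb{R}^n$, there exists a Euclidean matching on $\mathrm{Sal}(\mathcal{A})$ with base point $x_0$. Such a matching has exactly one critical cell $\langle C, F_C\rangle$ for every chamber $C \in \mathcal{C}(\mathcal{A})$, where $F_C$ is the smallest face of $C$ that contains the projection of $x_0$ onto $C$.
   Context: Arrangements. $\mathcal{A}$ is a locally finite set of affine hyperplanes in $\mathbb{R}^n$. Faces are the closures of the strata of the induced stratification of $\mathbb{R}^n$ (two points are in the same stratum iff, for each $H\in\mathcal{A}$, both lie on $H$ or both lie strictly on the same side of $H$), ordered by $F\preceq G\iff F\supseteq G$; chambers are faces of codimension $0$, and $\mathcal{C}=\mathcal{C}(\mathcal{A})$ is the set of chambers. $s(C,C')\subseteq\mathcal{A}$ is the set of hyperplanes separating the chambers $C,C'$; the partial order $\leq_C$ on $\mathcal{C}$ is $D'\leq_C D\iff s(C,D')\subseteq s(C,D)$. $\mathcal{L}$ is the poset of flats ((nonempty) intersections of hyperplanes of $\mathcal{A}$, including $\mathbb{R}^n$). $\mathrm{supp}(F)=\{H\in\mathcal{A}\mid F\subseteq H\}$. For a chamber $C$ and a face $F$, $C.F$ is the unique chamber $C'\supseteq F$ with $\mathrm{supp}(F)\cap s(C,C')=\emptyset$. If $F\subseteq C$, $C^F$ is the chamber opposite to $C$ with respect to $F$, i.e. the unique chamber $C'\supseteq F$ with $s(C,C')=\mathrm{supp}(F)$. Salvetti complex. $\mathrm{Sal}(\mathcal{A})$ is the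 poset of cells of the Salvetti complex: there is a $k$-cell $\langle C,F\rangle$ for each chamber $C$ and face $F$ of $C$ of codimension $k$, and $\langle C,F\rangle<\langle D,G\rangle$ iff $F\prec G$ and $D.F=C$. For a chamber $C$, $S(C)=\{\langle C',F\rangle\mid C'=C.F\}$; given a total order $\dashv$ of $\mathcal{C}$, $N(C)$ is the set of cells of $S(C)$ not in any $S(C')$ with $C'\dashv C$; the sets $N(C)$ partition $\mathrm{Sal}(\mathcal{A})$. Matchings. For a ranked poset $P$, let $\mathcal{E}=\{(p,q)\mid q\lessdot p\}$. A matching is a subset $\mathcal{M}\subseteq\mathcal{E}$ such that every element of $P$ appears in at most one edge of $\mathcal{M}$; it is acyclic if orienting $(p,q)\in\mathcal{E}$ from $p$ to $q$ when $(p,q)\notin\mathcal{M}$ and from $q$ to $p$ when $(p,q)\in\mathcal{M}$ gives no directed cycle. Elements in no edge of $\mathcal{M}$ are critical. $\mathcal{M}$ is homogeneous with respect to a poset map $\varphi\colon P\to Q$ if $\varphi(p)=\varphi(q)$ for all $(p,q)\in\mathcal{M}$. Euclidean matchings. $d$ is the Euclidean distance and $\rho_K$ the projection onto a closed convex set $K$. A point $x$ is generic (with respect to $\mathcal{A}$) if: (i) for all $C,C'\in\mathcal{C}$ with $d(x,C)=d(x,C')$ we have $\rho_C(x)=\rho_{C'}(x)\in C\cap C'$; (ii) for all $L,L'\in\mathcal{L}$ with $L'\subsetneq L$ we have $d(x,L')>d(x,L)$. A total order $\dashv_{eu}$ on $\mathcal{C}$ is Euclidean with base point $x_0$ if $x_0$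 is generic and $C\dashv_{eu}C'$ implies $d(x_0,C)\leq d(x_0,C')$. Given such an order, let $\eta\colon\mathrm{Sal}(\mathcal{A})\to\mathcal{C}\times\mathcal{C}$ be $\eta(\langle D,F\rangle)=(C,D^F)$, where $C$ is the chamber with $\langle D,F\rangle\in N(C)$; this is a poset map when $\mathcal{C}\times\mathcal{C}$ is ordered by the transitive closure of: $(C',E')\leq(C,E)$ iff ($C'=C$ or $C'\dashv_{eu}C$) and $E'\leq_C E$. An acyclic matching $\mathcal{M}$ on $\mathrm{Sal}(\mathcal{A})$ is a Euclidean matching with base point $x_0$ if: (i) $x_0$ is generic; (ii) $\mathcal{M}$ is homogeneous with respect to the map $\eta$ induced by a Euclidean order with base point $x_0$; (iii) there is exactly one critical cell $\langle C,F_C\rangle$ for every chamber $C$, where $F_C$ is the smallest face of $C$ containing $\rho_C(x_0)$. *)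

(* Defs.v *)
(* R^n is the space 'rV[R]_n of row vectors, with R : realType. *)
From mathcomp Require Import all_boot all_order all_algebra.
From mathcomp Require Import all_classical all_reals all_analysis.
From Stdlib Require Import Relation_Operators.
Import Order.TTheory GRing.Theory Num.Theory.
Import numFieldNormedType.Exports.

Set Implicit Arguments.
Unset Strict Implicit.
Unset Printing Implicit Defensive.

Local Open Scope classical_set_scope.
Local Open Scope ring_scope.

Section Euclidean.
Variables (R : realType) (n : nat).
Local Notation V := 'rV[R]_n.
Implicit Types (x y : V) (K F H : set V).

Definition dotv x y : R := \sum_(i < n) x 0 i * y 0 i.

(* The canonical norm of 'rV[R]_n is the sup norm, so the Euclidean distance is
   introduced separately; both induce the same topology. *)
Definition edist x y : R := Num.sqrt (dotv (x - y) (x - y)).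

Definition edist_set x K : R := inf [set edist x y | y in K].

Definition projection K x : V :=
  get [set y | K y /\ forall z, K z -> edist x y <= edist x z].

Definition hyperplane (a : V) (b : R) : set V := [set x | dotv a x = b].

Definition is_hyperplane H := exists a b, a != 0 /\ H = hyperplane a b.

(* V0 is the direction of the affine hull of F (for nonempty F). *)
Definition is_direction F (V0 : {vspace V}) :=
  (forall x y, F x -> F y -> x - y \in V0) /\
  (forall W : {vspace V},
     (forall x y, F x -> F y -> x - y \in W) -> (V0 <= W)%VS).

Definition has_codim F (k : nat) :=
  exists2 V0 : {vspace V}, is_direction F V0 & (\dim V0 + k)%N = n.

Definition strictly_same_side H x y := exists a b,
  [/\ a != 0, H = hyperplane a b & 0 < (dotv a x - b) * (dotv a y - b)].

End Euclidean.

Section Arrangement.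
Variables (R : realType) (n : nat).
Local Notation V := 'rV[R]_n.
Implicit Types (A : set (set V)) (x y : V) (C D E F G H L : set V).

Definition arrangement A := forall H, A H -> is_hyperplane H.

Definition locally_finite A := forall x,
  exists2 U, nbhs x U & finite_set [set H | A H /\ H `&` U !=set0].

Definition same_stratum A x y := forall H, A H ->
  (H x /\ H y) \/ strictly_same_side H x y.

Definition face A F := exists x, F = closure [set y | same_stratum A x y].

Definition chamber A C := face A C /\ has_codim C 0.

(* Chambers are closed and full-dimensional, hence the two closed half-spaces. *)
Definition sep A C C' : set (set V) := [set H | A H /\ exists a b,
  [/\ a != 0, H = hyperplane a b,
      C `<=` [set x | dotv a x <= b] & C' `<=` [set x | b <= dotv a x]]].

Definition chamber_le A C D' D := sep A C D' `<=` sep A C D.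

Definition flat A L := L !=set0 /\
  exists2 B : set (set V), B `<=` A & L = \bigcap_(H in B) H.

Definition supp A F : set (set V) := [set H | A H /\ F `<=` H].

(* C.F *)
Definition chamber_dot A C F : set V :=
  get [set C' | [/\ chamber A C', F `<=` C' & supp A F `&` sep A C C' = set0]].

(* C^F, meaningful for F `<=` C *)
Definition chamber_opp A C F : set V :=
  get [set C' | [/\ chamber A C', F `<=` C' & sep A C C' = supp A F]].

End Arrangement.

Section Salvetti.
Variables (R : realType) (n : nat).
Local Notation V := 'rV[R]_n.
Local Notation cell := (set V * set V)%type.
Implicit Types (A : set (set V)) (C : set V) (p q : cell).
Implicit Types ord : set V -> set V -> Prop.

(* The cell <C, F> is encoded as the pair (C, F); its dimension is codim F. *)
Definition Sal A : set cell :=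
  [set p | [/\ chamber A p.1, face A p.2 & p.2 `<=` p.1]].

(* F precedes G when F strictly contains G: faces are ordered by reverse inclusion. *)
Definition Sal_lt A p q := q.2 `<` p.2 /\ chamber_dot A q.1 p.2 = p.1.

Definition Sal_le A p q := p = q \/ Sal_lt A p q.

Definition Sal_S A C : set cell := [set p | Sal A p /\ p.1 = chamber_dot A C p.2].

Definition Sal_N A ord C : set cell :=
  [set p | Sal_S A C p /\ forall C', chamber A C' -> ord C' C -> ~ Sal_S A C' p].

(* The sets N(C) partition Sal A, so exactly one C qualifies when p is a cell. *)
Definition eta A ord p : set V * set V :=
  (get [set C | chamber A C /\ Sal_N A ord C p], chamber_opp A p.1 p.2).

Definition pair_step A ord (u' u : set V * set V) :=
  [/\ chamber A u'.1 /\ chamber A u'.2, chamber A u.1 /\ chamber A u.2,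
      u'.1 = u.1 \/ ord u'.1 u.1 & chamber_le A u.1 u'.2 u.2].

Definition pair_le A ord := clos_trans _ (pair_step A ord).

End Salvetti.

(* Posets are given by a carrier P : set T and a relation on T. *)
Section Matchings.
Variables (T : Type) (P : set T) (lt : T -> T -> Prop).
Implicit Types M : set (T * T).

Definition covers q p :=
  [/\ P q, P p, lt q p & ~ exists r, [/\ P r, lt q r & lt r p]].

Definition hasse_edges : set (T * T) := [set e | covers e.2 e.1].

Definition endpoint (p : T) (e : T * T) := p = e.1 \/ p = e.2.

Definition matching M := M `<=` hasse_edges /\
  forall p e e', M e -> M e' -> endpoint p e -> endpoint p e' -> e = e'.

Definition oriented_edge M (p q : T) :=
  (hasse_edges (p, q) /\ ~ M (p, q)) \/ (hasse_edges (q, p) /\ M (q, p)).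

Definition acyclic M := forall p, ~ clos_trans _ (oriented_edge M) p p.

Definition critical M : set T := [set p | P p /\ ~ exists2 e, M e & endpoint p e].

End Matchings.

Definition poset_map (T U : Type) (P : set T) (le : T -> T -> Prop)
  (Q : set U) (leQ : U -> U -> Prop) (phi : T -> U) :=
  (forall p, P p -> Q (phi p)) /\
  (forall p q, P p -> P q -> le p q -> leQ (phi p) (phi q)).

Definition homogeneous (T U : Type) (P : set T) (le : T -> T -> Prop)
  (Q : set U) (leQ : U -> U -> Prop) (phi : T -> U) (M : set (T * T)) :=
  poset_map P le Q leQ phi /\ forall p q, M (p, q) -> phi p = phi q.

Section EuclideanMatchings.
Variables (R : realType) (n : nat).
Local Notation V := 'rV[R]_n.
Local Notation cell := (set V * set V)%type.
Implicit Types (A : set (set V)) (x : V) (C : set V).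
Implicit Types (ord : set V -> set V -> Prop) (M : set (cell * cell)).

Definition generic A x :=
  (forall C C', chamber A C -> chamber A C' ->
     edist_set x C = edist_set x C' ->
     projection C x = projection C' x /\ (C `&` C') (projection C x)) /\
  (forall L L', flat A L -> flat A L' -> L' `<` L ->
     edist_set x L < edist_set x L').

Definition strict_total_order_on (T : Type) (Q : set T) (r : T -> T -> Prop) :=
  [/\ forall a, Q a -> ~ r a a,
      forall a b c, Q a -> Q b -> Q c -> r a b -> r b c -> r a c &
      forall a b, Q a -> Q b -> [\/ a = b, r a b | r b a]].

Definition euclidean_order A x ord :=
  [/\ strict_total_order_on (chamber A) ord, generic A x &
      forall C C', chamber A C -> chamber A C' -> ord C C' ->
        edist_set x C <= edist_set x C'].

Definition smallest_face A C x : set V :=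
  get [set F | [/\ face A F, F `<=` C, F x &
                   forall G, face A G -> G `<=` C -> G x -> F `<=` G]].

(* The critical cells are the <C, F_C>, one for each chamber C. *)
Definition one_critical_cell_per_chamber A x M :=
  critical (Sal A) M =
    [set (C, smallest_face A C (projection C x)) | C in chamber A].

Definition euclidean_matching A x M :=
  (matching (Sal A) (Sal_lt A) M /\ acyclic (Sal A) (Sal_lt A) M) /\
  [/\ generic A x,
      exists2 ord, euclidean_order A x ord &
        homogeneous (Sal A) (Sal_le A) (chamber A `*` chamber A)
          (pair_le A ord) (eta A ord) M &
      one_critical_cell_per_chamber A x M].

End EuclideanMatchings.

(* Main.v *)
(* Faces are encoded by sign vectors of points, so that the fiber of [eta] over
   (C, E) becomes a set of faces of E inside the flat spanned by F_C: by
   genericity, the cells of N(C) are the <C.F, F> whose face F lies in the affine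
   hull of F_C, and a nonempty fiber consists of those for which F is a face of E
   all of whose hyperplanes not containing F_C separate E from the projection
   z of x_0 onto C. If z is in E, only F_C survives; it is the critical cell.
   Otherwise the visible faces are matched along a line shelling: a line to z
   from a generic relative interior point q of the intersection of E with that
   flat meets the hyperplanes separating q from z at different times; the top
   face is matched with the first facet crossed, and the faces whose last crossed
   hyperplane is H are the faces of the facet on H visible from the crossing
   point, to which induction applies.
   The crossing times, read lexicographically, form a monotone potential whose
   fibers are the matched pairs, hence acyclicity. *)
Require Import Defs.
From mathcomp Require Import all_boot all_order all_algebra.
From mathcomp Require Import all_classical all_reals all_analysis.
From mathcomp Require Import ring lra.
From Stdlib Require Import Relation_Operators.
Import Order.TTheory GRing.Theory Num.Theory.
Import numFieldNormedType.Exports.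

Set Implicit Arguments.
Unset Strict Implicit.
Unset Printing Implicit Defensive.

Local Open Scope classical_set_scope.
Local Open Scope ring_scope.

(** * Sign vectors and visible faces *)

Section RealSigns.
Variable R : realFieldType.
Implicit Types a b t u : R.

Lemma sgr_cases a :
  [\/ a < 0 /\ Num.sg a = -1, a = 0 /\ Num.sg a = 0 | 0 < a /\ Num.sg a = 1].
Proof.
by case: (sgrP a) => h; [constructor 2|constructor 3|constructor 1].
Qed.

Lemma sgr_perturb a b : a != 0 ->
  exists2 e, 0 < e & forall t, 0 < t <= e -> Num.sg (a + t * b) = Num.sg a.
Proof.
move=> a0; have na : 0 < `|a| by rewrite normr_gt0.
have nb : 0 < `|b| + 1 by have := normr_ge0 b; lra.
(* The [+ 1] covers a vanishing [b] and makes the bound on [t * b] strict. *)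
exists (`|a| / (`|b| + 1)) => [|t /andP[t0]]; first exact: divr_gt0.
rewrite ler_pdivlMr // mulrDr mulr1 => tb.
have : `|t * b| < `|a| by rewrite normrM (gtr0_norm t0); lra.
rewrite ltr_norml.
case: (sgr_cases a) => -[h ->].
- by rewrite (ltr0_norm h) => /andP[h1 h2]; apply: ltr0_sg; lra.
- by rewrite h eqxx in a0.
- by rewrite (gtr0_norm h) => /andP[h1 h2]; apply: gtr0_sg; lra.
Qed.

Lemma sgr_perturb_seq (J : eqType) (a b : J -> R) (s : seq J) :
  exists2 e, 0 < e & forall t, 0 < t <= e ->
    forall j, j \in s -> a j != 0 -> Num.sg (a j + t * b j) = Num.sg (a j).
Proof.
elim: s => [|j s [e e0 he]]; first by exists 1.
case: (eqVneq (a j) 0) => [aj|aj].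
  exists e => // t ht k; rewrite inE => /orP[/eqP->|]; first by rewrite aj eqxx.
  exact: he.
have [e' e'0 he'] := sgr_perturb (b j) aj.
exists (Num.min e e') => [|t]; first by rewrite lt_min e0.
rewrite le_min => /and3P[t0 te te'] k.
by rewrite inE => /orP[/eqP->|ks]; [move=> _; apply: he' | apply: he]; rewrite ?t0.
Qed.

(** Affine intermediate value theorem: a change of sign would put the root [- a / b] into the unit
    interval. *)
Lemma sgr_no_root a b : (forall u, 0 <= u <= 1 -> a + u * b != 0) ->
  forall t, 0 <= t <= 1 -> Num.sg (a + t * b) = Num.sg a.
Proof.
move=> h t /andP[t0 t1].
have a0 : a != 0 by have := h 0; rewrite mul0r addr0 lexx ler01 => /(_ isT).
have ht := h t; rewrite t0 t1 in ht.
have {}ht := ht isT.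
have root : b != 0 -> 0 <= - a / b -> - a / b <= 1 -> False.
  move=> b0 h0 h1; have := h (- a / b); rewrite h0 h1 => /(_ isT).
  by rewrite divfK // subrr eqxx.
case: (sgr_cases a) => -[ha ->]; last 2 first.
- by rewrite ha eqxx in a0.
- apply: gtr0_sg; rewrite lt_def ht /= leNgt; apply/negP => neg.
  have b0 : b < 0 by nra.
  apply: root; first by rewrite lt_eqF.
    by rewrite ler_ndivlMr // mul0r; lra.
  by rewrite ler_ndivrMr //; nra.
- apply: ltr0_sg; rewrite lt_def eq_sym ht /= leNgt; apply/negP => pos.
  have b0 : 0 < b by nra.
  apply: root; first by rewrite gt_eqF.
    by rewrite ler_pdivlMr // mul0r; lra.
  by rewrite ler_pdivrMr //; nra.
Qed.

Lemma seq_argmax (I : eqType) (P : I -> Prop) (t : I -> R) (r : seq I) :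
  (exists2 i, i \in r & P i) ->
  exists i, [/\ i \in r, P i & forall j, j \in r -> P j -> t j <= t i].
Proof.
elim: r => [[]//|i r IH] [j]; rewrite inE => jr Pj.
case: (pselect (exists2 k, k \in r & P k)) => [/IH[k [kr Pk hk]]|no].
  case: (pselect (P i /\ t k <= t i)) => [[Pi ki]|nPi].
    exists i; rewrite inE eqxx; split=> // l; rewrite inE => /orP[/eqP->//|lr Pl].
    by apply: le_trans ki; apply: hk.
  exists k; rewrite inE kr orbT; split=> // l; rewrite inE => /orP[/eqP->|lr Pl].
    by move=> Pi; case: (leP (t i) (t k)) => // /ltW ki; case: nPi.
  exact: hk.
have {jr} ji : j = i.
  by case/orP: jr => [/eqP//|jr]; case: no; exists j.
subst j; exists i; rewrite inE eqxx; split=> // l.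
by rewrite inE => /orP[/eqP->//|lr Pl]; case: no; exists l.
Qed.

End RealSigns.

(** * Strata as sign vectors of a family of affine functions *)

Section SignVectors.
Variables (R : realFieldType) (V : lmodType R) (I : choiceType).
Variables (A : set I) (l : I -> V -> R).
Implicit Types (i : I) (f g q z x y : V) (U : set V).
Local Notation s i x := (Num.sg (l i x)).

(** A point stands for its stratum: the stratum of [f] lies in the closed stratum of [g]. *)
Definition fle f g := forall i, A i -> l i f = 0 \/ s i f = s i g.

Definition same f g := forall i, A i -> s i f = s i g.

Definition fcover f g :=
  [/\ fle f g, ~ fle g f & forall x, fle f x -> fle x g -> same x f \/ same x g].

(* The faces below [q] all of whose additional hyperplanes separate [q] from
   [z]: the part of the closed stratum of [q] visible from [z]. *)
Definition visible q z : set V := [set f | fle f q /\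
  forall i, A i -> l i f = 0 -> l i q != 0 -> s i z = - s i q].

Definition crossed q z : set I := [set i | [/\ A i, l i q != 0 & s i z = - s i q]].

(* A map to a total order whose fibers on [U] are matched pairs; the induced
   matching is acyclic because the map is monotone. *)
Definition matching_potential U (phi : V -> seqlexi R) :=
  (forall f g, U f -> U g -> fle f g -> (phi g <= phi f)%O) /\
  forall f, U f -> exists g, [/\ U g, phi g = phi f, fcover f g \/ fcover g f &
    forall x, U x -> phi x = phi f -> same x f \/ same x g].

Hypothesis affl : forall i x y t, l i (x + t *: (y - x)) = l i x + t * (l i y - l i x).
Hypothesis finl : forall x y,
  finite_set [set i | A i /\ exists2 t, 0 <= t <= 1 & l i (x + t *: (y - x)) = 0].

Lemma sgl_eq0 i x : s i x = 0 <-> l i x = 0.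
Proof. by split=> [/eqP|->]; [rewrite sgr_eq0 => /eqP | rewrite sgr0]. Qed.

Lemma fle_refl f : fle f f. Proof. by move=> i _; right. Qed.

Lemma fle_trans f g x : fle f g -> fle g x -> fle f x.
Proof.
move=> fg gx i Ai; case: (fg i Ai) => [|e1]; first by left.
case: (gx i Ai) => [g0|e2]; [left|by right; rewrite e1].
by apply/sgl_eq0; rewrite e1; apply/sgl_eq0.
Qed.

Lemma same_sym f g : same f g -> same g f.
Proof. by move=> h i Ai; rewrite h. Qed.

Lemma same_trans f g x : same f g -> same g x -> same f x.
Proof. by move=> h1 h2 i Ai; rewrite h1 // h2. Qed.

Lemma same_fle f g : same f g -> fle f g.
Proof. by move=> h i Ai; right; apply: h. Qed.

Lemma fle_anti f g : fle f g -> fle g f -> same f g.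
Proof.
move=> fg gf i Ai; case: (fg i Ai) => // f0; case: (gf i Ai) => // g0.
by rewrite f0 g0.
Qed.

Lemma same0 f g i : same f g -> A i -> l i f = 0 -> l i g = 0.
Proof. by move=> fg Ai /sgl_eq0 f0; apply/sgl_eq0; rewrite -fg. Qed.

Lemma fle0 f g i : fle f g -> A i -> l i g = 0 -> l i f = 0.
Proof. by move=> fg Ai g0; case: (fg i Ai) => // e; apply/sgl_eq0; rewrite e g0 sgr0. Qed.

Lemma same_visible q q' z f : same q q' -> visible q z f -> visible q' z f.
Proof.
move=> qq [fq h]; split; first by apply: fle_trans fq _; apply: same_fle.
move=> i Ai f0 q0; rewrite -qq //; apply: h => //.
by apply: contra q0 => /eqP q0; apply/eqP/(same0 qq).
Qed.

Lemma visible_same q z f g : same f g -> visible q z f -> visible q z g.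
Proof.
move=> fg [fq h]; split; first by apply: fle_trans fq; apply/same_fle/same_sym.
by move=> i Ai g0; apply: h => //; apply: same0 g0 => //; apply: same_sym.
Qed.

Lemma fcover_same f f' g g' : same f f' -> same g g' -> fcover f g -> fcover f' g'.
Proof.
move=> ff gg [h1 h2 h3]; split.
- by apply: fle_trans (fle_trans h1 (same_fle gg)); apply/same_fle/same_sym.
- move=> h; apply: h2; apply: fle_trans (fle_trans h _).
    exact: same_fle.
  by apply/same_fle/same_sym.
- move=> x fx xg; case: (h3 x).
  + by apply: fle_trans fx; apply: same_fle.
  + by apply: fle_trans xg _; apply/same_fle/same_sym.
  + by move=> xf; left; apply: same_trans xf ff.
  + by move=> xf; right; apply: same_trans xf gg.
Qed.

(** The family may be infinite, but only finitely many of its functions vanish somewhere on the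
    segment. These, and the list [r], bound the step size; all others keep their sign on the whole
    segment. *)
Lemma push_seq (J : eqType) (a b : J -> R) (r : seq J) x y :
  exists t, [/\ 0 < t <= 1,
    forall i, A i -> l i x != 0 -> s i (x + t *: (y - x)) = s i x &
    forall j, j \in r -> a j != 0 -> Num.sg (a j + t * b j) = Num.sg (a j)].
Proof.
have /finite_seqP[m hm] := finl x y.
have [e e0 he] := sgr_perturb_seq (fun i => l i x) (fun i => l i y - l i x) m.
have [e' e'0 he'] := sgr_perturb_seq a b r.
pose t := Num.min (Num.min e e') 1.
have t0 : 0 < t by rewrite !lt_min e0 e'0 ltr01.
have [te te' t1] : [/\ t <= e, t <= e' & t <= 1].
  by rewrite /t !ge_min !lexx /= !orbT.
exists t; split; [by rewrite t0|move=> i Ai x0|by apply: he'; rewrite t0].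
rewrite affl; case: (boolP (i \in m)) => im.
  by apply: (he t _ i im x0); rewrite t0.
apply: sgr_no_root; last by rewrite ltW.
move=> u u01; apply/eqP => zero.
have : [set` m] i by rewrite -hm; split=> //; exists u => //; rewrite affl.
by rewrite /= (negbTE im).
Qed.

Lemma push x y : exists t, 0 < t <= 1 /\
  forall i, A i -> l i x != 0 -> s i (x + t *: (y - x)) = s i x.
Proof.
by have [t [h1 h2 _]] := push_seq (fun _ : I => 0) (fun=> 0) [::] x y; exists t.
Qed.

Lemma sg_push i x y t : 0 < t -> l i x = 0 -> s i (x + t *: (y - x)) = s i y.
Proof. by move=> t0 x0; rewrite affl x0 subr0 add0r sgrM gtr0_sg ?mul1r. Qed.

(** The product of sign vectors, realized by a small step from [x] towards [y]. *)
Lemma composition x y : exists w, forall i, A i ->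
  s i w = if l i x == 0 then s i y else s i x.
Proof.
have [t [/andP[t0 _] ht]] := push x y; exists (x + t *: (y - x)) => i Ai.
by case: eqVneq => [x0|x0]; [apply: sg_push | apply: ht].
Qed.

(** The product of [x] with the point reflection of [y] in [x]. *)
Lemma reflection x y : exists w, forall i, A i ->
  s i w = if l i x == 0 then - s i y else s i x.
Proof.
have [w hw] := composition x (x + (-1) *: (y - x)).
exists w => i Ai; rewrite hw //; case: eqVneq => // x0.
by rewrite affl x0 subr0 add0r mulN1r sgrN.
Qed.

Lemma crossed_finite q z : finite_set (crossed q z).
Proof.
apply: sub_finite_set (finl q z) => i [Ai q0 e]; split=> //.
have d0 : l i q - l i z != 0.
  apply/eqP => /eqP; rewrite subr_eq0 => /eqP qz.
  by move: e q0; rewrite -qz -sgr_eq0; case: (sgr_cases (l i q)) => -[_ ->]; 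
    rewrite ?eqxx // => e; exfalso; lra.
exists (l i q / (l i q - l i z)); last by rewrite affl; field.
move: e; case: (sgr_cases (l i q)) => -[hq ->]; case: (sgr_cases (l i z)) => -[hz ->] e;
  try (exfalso; lra).
- have h : l i q - l i z < 0 by lra.
  by rewrite ler_ndivlMr // ler_ndivrMr //; lra.
- have h : 0 < l i q - l i z by lra.
  by rewrite ler_pdivlMr // ler_pdivrMr //; lra.
Qed.

(** General position inside a stratum: small pushes within the flat of [q] leave, one after another,
    the zero sets of those [h j] that do not vanish on this flat, and are small enough to keep what
    was achieved before. *)
Lemma avoid (J : eqType) (h : J -> V -> R) (r : seq J) q :
  (forall j x y t, h j (x + t *: (y - x)) = h j x + t * (h j y - h j x)) ->
  exists2 q', same q q' & forall j, j \in r -> h j q' = 0 ->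
    forall x, (forall i, A i -> l i q = 0 -> l i x = 0) -> h j x = 0.
Proof.
move=> aff; elim: r => [|k r [q1 qq1 IH]]; first by exists q.
case: (pselect (h k q1 = 0 ->
  forall x, (forall i, A i -> l i q = 0 -> l i x = 0) -> h k x = 0)) => [hk|].
  by exists q1 => // j; rewrite inE => /orP[/eqP->//|]; apply: IH.
move=> /not_implyP[hk0 /existsNP[x /not_implyP[Xx /eqP hkx]]].
have [t [/andP[t0 t1] ht hr]] :=
  push_seq (fun j => h j q1) (fun j => h j x - h j q1) r q1 x.
exists (q1 + t *: (x - q1)) => [i Ai|j].
  rewrite qq1 //; case: (eqVneq (l i q1) 0) => [q10|q10]; last by rewrite ht.
  rewrite sg_push // q10 Xx ?sgr0 //; apply: same0 q10 => //; exact: same_sym.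
rewrite inE aff => /orP[/eqP->|jr h0].
  rewrite hk0 add0r subr0 => /eqP; rewrite mulf_eq0 (negbTE hkx) orbF.
  by rewrite gt_eqF.
apply: (IH j jr); apply/eqP/negPn/negP => n0.
by have := hr j jr n0; rewrite h0 sgr0 => /esym/eqP; rewrite sgr_eq0 (negbTE n0).
Qed.

(** * Line shelling along the segment from [q] to [z] *)

Section Sweep.
Variables q z : V.
Hypothesis qz : forall i, A i -> l i q = 0 -> l i z = 0.

(** For a crossed [i], the time at which the segment meets the zero set of [l i]. *)
Let c i := l i q / (l i q - l i z).
Let p t := q + t *: (z - q).

Lemma crossed_gap i : crossed q z i -> Num.sg (l i q - l i z) = s i q.
Proof.
move=> [_ q0]; case: (sgr_cases (l i q)) => -[hq eq]; case: (sgr_cases (l i z)) => -[hz ez];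
  rewrite eq ez => e; try (exfalso; lra).
- by apply: ltr0_sg; lra.
- by apply: gtr0_sg; lra.
Qed.

Lemma crossed_time i : crossed q z i -> 0 < c i < 1.
Proof.
move=> ci; have := crossed_gap ci; case: ci => _ q0.
rewrite /c; case: (sgr_cases (l i q)) => -[hq ->].
- move=> e d; have {d} : l i q - l i z < 0 by rewrite -sgr_lt0 d ltrN10.
  move=> d; have hz : 0 < l i z by rewrite -sgr_gt0 e opprK.
  by rewrite ltr_ndivlMr // mul0r hq ltr_ndivrMr // mul1r; lra.
- by rewrite hq eqxx in q0.
- move=> e d; have {d} : 0 < l i q - l i z by rewrite -sgr_gt0 d.
  move=> d; have hz : l i z < 0 by rewrite -sgr_lt0 e ltrN10.
  by rewrite ltr_pdivlMr // mul0r hq ltr_pdivrMr // mul1r; lra.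
Qed.

Lemma sg_crossed i t : crossed q z i -> s i (p t) = s i q * Num.sg (c i - t).
Proof.
move=> ci; rewrite -(crossed_gap ci) -sgrM /p affl; congr Num.sg.
have : l i q - l i z != 0.
  by case: (ci) => _ q0 _; rewrite -sgr_eq0 crossed_gap // sgr_eq0.
by rewrite /c => d; field.
Qed.

(** Time 1 is excluded because [z] may lie on an uncrossed hyperplane. *)
Lemma sg_uncrossed i t : A i -> ~ crossed q z i -> 0 <= t < 1 -> s i (p t) = s i q.
Proof.
move=> Ai nc /andP[t0 t1]; rewrite /p affl.
case: (eqVneq (l i q) 0) => [q0|q0].
  by rewrite q0 (qz Ai q0) subrr mulr0 addr0.
have : s i z <> - s i q by move=> e; apply: nc; split.
case: (sgr_cases (l i q)) => -[hq ->]; case: (sgr_cases (l i z)) => -[hz ->] ne;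
  rewrite ?opprK in ne; try (by rewrite hq eqxx in q0); try by case: ne.
- by apply: ltr0_sg; nra.
- by apply: ltr0_sg; rewrite hz; nra.
- by apply: gtr0_sg; rewrite hz; nra.
- by apply: gtr0_sg; nra.
Qed.

Lemma sgr_neq_opp (a : R) : a != 0 -> Num.sg a = - Num.sg a -> False.
Proof. by case: (sgr_cases a) => -[h ->]; rewrite ?h ?eqxx // => _ e; lra. Qed.

(* [q'] spans the part of the stratum of [q] cut out by the hyperplanes that
   the segment from [q] to [z] crosses at time [t]. *)
Definition section_at t q' := [/\ fle q' q,
  forall i, A i -> l i q = 0 -> l i q' = 0,
  forall i, crossed q z i -> c i = t -> l i q' = 0 &
  forall i, A i -> l i q' = 0 -> l i q = 0 \/ crossed q z i /\ c i = t].

(** Selects the shelling step of a visible proper face: among the hyperplanes through [f] but not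
    [q], the last one met by the line decides. *)
Definition last_time f t :=
  [/\ forall i, A i -> l i f = 0 -> l i q != 0 -> c i <= t &
      exists i, [/\ crossed q z i, l i f = 0 & c i = t]].

(** Several hyperplanes may have the same trace on the flat of [q], so simultaneous crossings cannot
    be excluded; they are only required to have equal traces. *)
Hypothesis generic_line : forall i j, crossed q z i -> crossed q z j -> c i = c j ->
  forall x, (forall k, A k -> l k q = 0 -> l k x = 0) -> l i x = 0 -> l j x = 0.

Lemma section_sg t q' i : section_at t q' -> A i -> l i q' != 0 -> s i q' = s i q.
Proof. by move=> [h _ _ _] Ai; case: (h i Ai) => [->|//]; rewrite eqxx. Qed.

Lemma last_time_lt1 f t : last_time f t -> 0 < t < 1.
Proof. by move=> [_ [i [ci _ <-]]]; apply: crossed_time. Qed.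

(** This is the hypothesis [qz] for the pair [q'], [p t], so the sweep can be repeated inside the
    section. *)
Lemma section_span t q' : section_at t q' ->
  forall i, A i -> l i q' = 0 -> l i (p t) = 0.
Proof.
move=> [_ _ _ h] i Ai /(h i Ai)[q0|[ci <-]].
  by rewrite /p affl q0 (qz Ai q0) subrr mulr0 addr0.
by apply/sgl_eq0; rewrite sg_crossed // subrr sgr0 mulr0.
Qed.

(** Hyperplanes crossed before [t] have [q] and [p t] on opposite sides, while those crossed at [t]
    contain the section and drop out; this drives the induction. *)
Lemma section_crossed t q' : 0 < t < 1 -> section_at t q' ->
  crossed q' (p t) = [set i | crossed q z i /\ c i < t].
Proof.
move=> /andP[t0 t1] hq'; case: (hq') => [h1 h2 h3 h4]; apply/seteqP; split=> i.
  move=> [Ai q'0]; rewrite (section_sg hq') // => e.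
  have q0 : l i q != 0 by apply: contra q'0 => /eqP/(h2 i Ai)->.
  have ci : crossed q z i.
    apply: contrapT => nc; move: e; rewrite sg_uncrossed // ?(ltW t0) //.
    exact: sgr_neq_opp.
  split=> //; move: e; rewrite sg_crossed //.
  case: (sgr_cases (c i - t)) => -[h ->]; first by move=> _; lra.
    by rewrite mulr0 => /eqP; rewrite eq_sym oppr_eq0 sgr_eq0 (negbTE q0).
  by rewrite mulr1 => /(sgr_neq_opp q0).
move=> [ci lt]; case: (ci) => Ai q0 _.
have q'0 : l i q' != 0.
  by apply/eqP => /(h4 i Ai)[/eqP|[_ e]]; rewrite ?(negbTE q0) // e ltxx in lt *.
split=> //; rewrite (section_sg hq') // sg_crossed //.
by rewrite (@ltr0_sg _ (c i - t)) ?mulrN1 // subr_lt0.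
Qed.

(** Together with [section_visible], this identifies the faces of step [t] with the faces of the
    section visible from the crossing point. By [generic_line], a face on one hyperplane crossed at
    [t] lies on all of them. *)
Lemma last_time_section f t q' : visible q z f -> last_time f t -> section_at t q' ->
  visible q' (p t) f.
Proof.
move=> [fq hf] lf hq'; case: (hq') => [h1 h2 h3 h4]; case: (lf) => ub [j [cj fj cjt]].
split=> i Ai.
  case: (eqVneq (l i q') 0) => [q'0|q'0].
    left; case: (h4 i Ai q'0) => [q0|[ci cit]]; first exact: (fle0 fq).
    apply: (generic_line cj ci _ _ fj); first by rewrite cit.
    by move=> k Ak qk; apply: (fle0 fq).
  by rewrite (section_sg hq') //; apply: fq.
move=> f0 q'0.
have q0 : l i q != 0 by apply: contra q'0 => /eqP/(h2 i Ai)->.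
have ci : crossed q z i by split=> //; apply: hf.
have : crossed q' (p t) i.
  rewrite (section_crossed (last_time_lt1 lf) hq'); split=> //.
  rewrite lt_neqAle ub // andbT; apply: contra q'0 => /eqP/(h3 i ci) ->; exact: eqxx.
by case.
Qed.

Lemma section_visible f t q' : (exists2 i, crossed q z i & c i = t) ->
  section_at t q' -> visible q' (p t) f -> visible q z f /\ last_time f t.
Proof.
move=> [j cj cjt] hq' [fq hf]; case: (hq') => [h1 h2 h3 h4].
have t01 : 0 < t < 1 by rewrite -cjt crossed_time.
have key i : A i -> l i f = 0 -> l i q != 0 -> crossed q z i /\ c i <= t.
  move=> Ai f0 q0; case: (eqVneq (l i q') 0) => [q'0|q'0].
    case: (h4 i Ai q'0) => [/eqP|[ci ->]]; first by rewrite (negbTE q0).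
    by rewrite lexx.
  have : crossed q' (p t) i by split=> //; apply: hf.
  by rewrite (section_crossed t01 hq') => -[ci /ltW].
split; split.
- exact: fle_trans fq h1.
- by move=> i Ai f0 q0; case: (key i Ai f0 q0) => -[].
- by move=> i Ai f0 q0; case: (key i Ai f0 q0).
- exists j; split=> //; case: (cj) => Aj _ _; apply: (fle0 fq) => //; exact: h3.
Qed.

(** Stepping from [f] away from [p t] works: hyperplanes through [f] crossed before [t] have [p t]
    on the far side, so the side of [q] is restored; those crossed at [t] contain [p t]; off [f] the
    signs of [f] are those of [q]. *)
Lemma section_exists f t : visible q z f -> last_time f t ->
  exists q', section_at t q'.
Proof.
move=> [fq hf] lf; case: (lf) => ub [j [cj fj cjt]].
have [q' hq'] := reflection f (p t); exists q'.
have main i : A i -> [\/ l i q = 0 /\ s i q' = 0,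
   [/\ crossed q z i, c i = t & s i q' = 0] |
   [/\ l i q != 0, ~ (crossed q z i /\ c i = t) & s i q' = s i q]].
  move=> Ai; rewrite hq' //; case: eqVneq => [f0|f0].
    case: (eqVneq (l i q) 0) => [q0|q0].
      constructor 1; split=> //.
      by rewrite /p affl q0 (qz Ai q0) subrr mulr0 addr0 sgr0 oppr0.
    have ci : crossed q z i by split=> //; apply: hf.
    have := ub i Ai f0 q0; rewrite le_eqVlt => /orP[/eqP cit|lt].
      by constructor 2; split=> //; rewrite sg_crossed // cit subrr sgr0 mulr0 oppr0.
    constructor 3; split=> //; first by case=> _ e; rewrite e ltxx in lt.
    by rewrite sg_crossed // (@ltr0_sg _ (c i - t)) ?mulrN1 ?opprK // subr_lt0.
  have sf : s i f = s i q by case: (fq i Ai) => // h; rewrite h eqxx in f0.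
  constructor 3; split=> //.
    by apply: contra f0 => /eqP q0; apply/eqP/(fle0 fq).
  move=> [ci cit]; move/eqP: f0; apply; apply: (generic_line cj ci _ _ fj).
    by rewrite cit.
  by move=> k Ak qk; apply: (fle0 fq).
split.
- move=> i Ai; case: (main i Ai) => [[_ /sgl_eq0]|[_ _ /sgl_eq0]|[]]; by [left|right].
- move=> i Ai q0; apply/sgl_eq0; case: (main i Ai) => [[]|[]|[_ _ ->]] //.
  by rewrite q0 sgr0.
- move=> i ci cit; case: (ci) => Ai _ _; apply/sgl_eq0.
  by case: (main i Ai) => [[]|[]|[_ []]].
- move=> i Ai q'0; case: (main i Ai) => [[]|[]|[q0 _]]; [by left|by right|].
  by rewrite q'0 sgr0 => /esym/eqP; rewrite sgr_eq0 (negbTE q0).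
Qed.

(** No hyperplane has been passed yet, so the first crossing point is itself in the relative
    interior of the first facet. *)
Lemma first_section i0 : crossed q z i0 ->
  (forall i, crossed q z i -> c i0 <= c i) -> section_at (c i0) (p (c i0)).
Proof.
move=> c0 min; have /andP[t0 t1] := crossed_time c0.
split=> i.
- move=> Ai; case: (pselect (crossed q z i)) => [ci|nc]; last first.
    by right; rewrite sg_uncrossed // (ltW t0).
  have := min i ci; rewrite le_eqVlt => /orP[/eqP e|lt]; [left|right].
    by apply/sgl_eq0; rewrite sg_crossed // e subrr sgr0 mulr0.
  by rewrite sg_crossed // (@gtr0_sg _ (c i - c i0)) ?mulr1 // subr_gt0.
- by move=> Ai i_q; rewrite /p affl i_q (qz Ai i_q) subrr mulr0 addr0.
- by move=> ci e; apply/sgl_eq0; rewrite sg_crossed // e subrr sgr0 mulr0.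
- move=> Ai /sgl_eq0; case: (pselect (crossed q z i)) => [ci|nc].
    rewrite sg_crossed // => /eqP; rewrite mulf_eq0 !sgr_eq0.
    case: (ci) => _ /negbTE -> _ /=; rewrite subr_eq0 => /eqP e; by right.
  by rewrite sg_uncrossed // ?(ltW t0) // => /sgl_eq0; left.
Qed.

(** The potential records the last crossing time, followed by the potential of the section at that
    time. *)
Lemma sweep_potential :
  crossed q z !=set0 ->
  (forall q' z', (forall i, A i -> l i q' = 0 -> l i z' = 0) ->
     crossed q' z' `<` crossed q z -> crossed q' z' !=set0 ->
     exists phi, matching_potential (visible q' z') phi) ->
  exists phi, matching_potential (visible q z) phi.
Proof.
move=> [i1 ci1] IH.
have /finite_seqP[r hr] := crossed_finite q z.
have inr i : crossed q z i -> i \in r by rewrite hr.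
have [i0 [_ c0 min]] : exists i, [/\ i \in r, crossed q z i &
    forall j, j \in r -> crossed q z j -> - c j <= - c i].
  by apply: seq_argmax; exists i1; rewrite ?inr.
have {}min i : crossed q z i -> c i0 <= c i.
  by move=> ci; rewrite -lerN2; apply: min => //; apply: inr.
set t0 := c i0.
have t01 : 0 < t0 < 1 := crossed_time c0.
have hq0 := first_section c0 min.
(* The value 0 for the stratum of [q] lies below all crossing times. *)
have [tau htau] : {tau : V -> R & forall f, visible q z f ->
    last_time f (tau f) \/ tau f = 0 /\ same f q}.
  apply: (@choice _ _ (fun f t => visible q z f -> last_time f t \/ t = 0 /\ same f q)).
  move=> f; case: (pselect (visible q z f)) => [vf|]; last by exists 0.
  case: (pselect (exists2 i, i \in r & [/\ A i, l i f = 0 & l i q != 0])).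
    move=> /(@seq_argmax _ _ _ c)[i [_ [Ai f0 q0] ub]].
    have cr j : A j -> l j f = 0 -> l j q != 0 -> crossed q z j.
      by move=> Aj fj qj; case: vf => _ h; split=> //; apply: h.
    exists (c i) => _; left; split; last by exists i; split=> //; apply: cr.
    by move=> j Aj fj qj; apply: ub => //; apply: inr; apply: cr.
  move=> no; exists 0 => _; right; split=> //.
  case: (vf) => fq h; apply: fle_anti => // i Ai.
  case: (eqVneq (l i q) 0) => [|q0]; [by left|right].
  case: (fq i Ai) => // f0; case: no; exists i => //; apply: inr; split=> //.
  exact: h.
have tau0 f t : visible q z f -> last_time f t -> tau f = t.
  move=> vf [ub [j [cj fj cjt]]]; case: (cj) => Aj qj _.
  case: (htau f vf) => [[ub' [k [[Ak qk ek] fk ckt]]]|[_ sf]].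
    by apply/eqP; rewrite eq_le -{1}ckt ub //= -cjt ub'.
  by move: qj; rewrite (same0 sf Aj fj) eqxx.
have tau_mono f g : visible q z f -> visible q z g -> fle f g -> tau g <= tau f.
  move=> vf vg fg; have lf := htau f vf.
  have f0 : 0 <= tau f.
    by case: lf => [/last_time_lt1/andP[/ltW]|[->]].
  case: (htau g vg) => [[_ [j [[Aj qj ej] gj <-]]]|[->//]].
  have fj : l j f = 0 by apply: (fle0 fg).
  case: lf => [[ub _]|[_ sf]]; first exact: ub.
  by move: qj; rewrite (same0 sf Aj fj) eqxx.
have qv : visible q z q by split=> [|i Ai -> /eqP//]; exact: fle_refl.
(* No hyperplane is crossed before [t0], so a face of step [t0] lies on no hyperplane beyond those
   of the section: it is the first facet itself. *)
have low x : visible q z x -> tau x <= t0 -> same x q \/ same x (p t0).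
  move=> vx; case: (htau x vx) => [lx|[_ ]]; last by left.
  move=> le; have e : tau x = t0.
    by apply/eqP; rewrite eq_le le /=; case: lx => _ [j [cj _ <-]]; apply: min.
  rewrite e in lx; have [xp h] := last_time_section vx lx hq0.
  right; apply: fle_anti => // i Ai.
  case: (eqVneq (l i (p t0)) 0) => [|p0]; [by left|right].
  case: (xp i Ai) => // x0; have : crossed (p t0) (p t0) i by split=> //; apply: h.
  by rewrite (section_crossed t01 hq0) => -[/min]; rewrite leNgt => /negP.
have [pv pl] : visible q z (p t0) /\ last_time (p t0) t0.
  apply: section_visible hq0 _; first by exists i0.
  by split=> [|i Ai -> /eqP//]; exact: fle_refl.
have taup : tau (p t0) = t0 by apply: tau0.
have tauq : tau q <= t0.
  case: (htau q qv) => [[_ [j [[_ /eqP qj _] ]]]|[-> _]] //.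
  by case/andP: t01 => /ltW.
have pq : fcover (p t0) q.
  case: (c0) => A0 q0 _; case: (hq0) => h1 h2 h3 h4; split=> //.
    move=> h; move/eqP: q0; apply; apply: (fle0 h) => //; exact: h3.
  move=> x px xq.
  suff [h|h] : same x q \/ same x (p t0) by [right|left].
  apply: low.
    split=> // i Ai x0 qi; case: (h4 i Ai (fle0 px Ai x0)) => [/eqP|[[]]] //.
    by rewrite (negbTE qi).
  rewrite -taup; apply: tau_mono => //.
  split=> // i Ai x0 qi; case: (h4 i Ai (fle0 px Ai x0)) => [/eqP|[[]]] //.
  by rewrite (negbTE qi).
have [psi hpsi] : {psi : R -> V -> seqlexi R & forall t, t0 < t ->
    matching_potential [set f | visible q z f /\ tau f = t] (psi t)}.
  apply: (@choice _ _ (fun t psi => t0 < t ->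
    matching_potential [set f | visible q z f /\ tau f = t] psi)) => t.
  case: (pselect (exists2 f, visible q z f & tau f = t)); last first.
    move=> no; exists (fun=> [::]) => _; split=> [f g [vf ft]|f [vf ft]];
      by case: no; exists f.
  move=> [f vf ft]; case: (boolP (t0 < t)) => [lt|]; last by exists (fun=> [::]).
  have lf : last_time f t.
    rewrite -ft; case: (htau f vf) => // -[e _]; move: lt; rewrite -ft e.
    by case/andP: t01 => /ltW; rewrite leNgt => /negbTE ->.
  have [q' hq'] := section_exists vf lf.
  have [j [cj fj cjt]] : exists i, [/\ crossed q z i, l i f = 0 & c i = t] by case: lf.
  have t_01 := last_time_lt1 lf.
  have -> : [set f | visible q z f /\ tau f = t] = visible q' (p t).
    apply/seteqP; split=> g.
      move=> [vg gt]; apply: last_time_section => //.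
      rewrite -gt; case: (htau g vg) => // -[e _]; move: t_01; rewrite -gt e ltxx //.
    move=> /section_visible; case=> //; first by exists j.
    by move=> vg lg; split=> //; apply: tau0.
  have [phi hphi] : exists phi, matching_potential (visible q' (p t)) phi.
    (* The hyperplane [j], met at time [t], is no longer crossed, which makes the inclusion strict;
       [i0] still is, so the crossed set is nonempty. *)
    apply: IH; first exact: section_span.
      rewrite section_crossed //; split=> [|h]; first by move=> i [].
      by have [_] := h j cj; rewrite cjt ltxx.
    by rewrite section_crossed //; exists i0.
  by exists phi.
(* The empty sequence is lexicographically least; it is the common value of the matched pair formed
   by [q] and [p t0]. *)
pose phi f : seqlexi R := if tau f <= t0 then [::] else tau f :: psi (tau f) f.
exists phi; split=> [f g vf vg fg|f vf].
  have := tau_mono f g vf vg fg; rewrite /phi.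
  case: (leP (tau g) t0) => [_ _|gt le]; first exact: lexi0s.
  case: (leP (tau f) t0) => [/(le_trans le)|ft]; first by rewrite leNgt gt.
  rewrite lexi_cons le /=; apply/implyP => ge.
  have e : tau f = tau g by apply/eqP; rewrite eq_le ge.
  by rewrite e; apply: (proj1 (hpsi _ gt)).
case: (leP (tau f) t0) => ft.
  have phi0 x : visible q z x -> phi x = phi f -> same x q \/ same x (p t0).
    move=> vx; rewrite /phi ft; case: (leP (tau x) t0) => // h _; exact: low.
  case: (low f vf ft) => sf.
    exists (p t0); split=> //; first by rewrite /phi taup lexx ft.
      right; apply: fcover_same pq => //; exact: same_sym.
    move=> x vx /(phi0 x vx)[h|]; last by right.
    by left; apply: same_trans h _; apply: same_sym.
  exists q; split=> //; first by rewrite /phi tauq ft.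
    left; apply: fcover_same pq => //; exact: same_sym.
  move=> x vx /(phi0 x vx)[|h]; first by right.
  by left; apply: same_trans h _; apply: same_sym.
have [g [[vg gt] pg fg hg]] := proj2 (hpsi _ ft) f (conj vf erefl).
exists g; split=> //; first by rewrite /phi gt leNgt ft /= pg.
move=> x vx; rewrite /phi (leNgt (tau f)) ft /=; case: leP => // _ [xt px].
by apply: hg; [split|rewrite -px xt].
Qed.

End Sweep.

(** Induction on a bound for the number of crossed hyperplanes, after moving [q] inside its stratum
    to make the line to [z] generic. *)
Lemma visible_potential q z : (forall i, A i -> l i q = 0 -> l i z = 0) ->
  crossed q z !=set0 -> exists phi, matching_potential (visible q z) phi.
Proof.
move=> qz ne; have /finite_seqP[r hr] := crossed_finite q z.
have [m] := ubnP (size r).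
have {hr} : crossed q z `<=` [set` r] by rewrite hr.
elim: m r q z qz ne => // m IH r q z qz ne cr sr.
(* For crossed [i] and [j], this vanishes exactly at the starting points from which both are met at
   the same time; it is affine in [x], so [avoid] applies. *)
pose h (ij : I * I) x := l ij.1 x * l ij.2 z - l ij.2 x * l ij.1 z.
have [q' qq' gen] : exists2 q', same q q' &
    forall ij, ij \in [seq (i, j) | i <- r, j <- r] -> h ij q' = 0 ->
    forall x, (forall i, A i -> l i q = 0 -> l i x = 0) -> h ij x = 0.
  by apply: avoid => -[i j] x y t; rewrite /h /= !affl; ring.
have q'q := same_sym qq'.
have cE : crossed q' z = crossed q z.
  apply/seteqP; split=> i [Ai q0 e]; split=> //.
  - by apply: contra q0 => /eqP q0; apply/eqP/(same0 qq').
  - by rewrite e q'q.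
  - by apply: contra q0 => /eqP q0; apply/eqP/(same0 q'q).
  - by rewrite e qq'.
have -> : visible q z = visible q' z.
  by apply/seteqP; split=> f; apply: same_visible.
apply: sweep_potential; rewrite ?cE //.
- by move=> i Ai q0; apply: qz => //; apply: (same0 q'q).
- move=> i j ci cj tij x Xx xi.
  have /gen hij : (i, j) \in [seq (i, j) | i <- r, j <- r].
    by rewrite allpairs_f // ?cr //; apply: cr.
  have nz k (ck : crossed q z k) : l k q' - l k z != 0.
    rewrite -cE in ck; rewrite -sgr_eq0 (crossed_gap ck).
    by case: ck => _ q0 _; rewrite sgr_eq0.
  have zj : l i z != 0.
    by case: ci => _ q0 e; rewrite -sgr_eq0 e oppr_eq0 sgr_eq0.
  have : h (i, j) x = 0.
    apply: hij => [|k Ak q0]; last by apply: Xx => //; apply: (same0 qq').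
    move/eqP: tij; rewrite eqr_div ?nz // => /eqP e.
    by rewrite /h /=; lra.
  rewrite /h /= xi mul0r sub0r => /eqP; rewrite oppr_eq0 mulf_eq0 (negbTE zj) orbF.
  by move/eqP.
- move=> q1 z1 qz1 [sub nsub] ne1.
  have [i ci nci] : exists2 i, crossed q z i & ~ crossed q1 z1 i.
    apply: contrapT => no; apply: nsub => i ci; apply: contrapT => nci.
    by apply: no; exists i.
  (* A hyperplane that is no longer crossed is deleted from the list, which shortens it. *)
  apply: (IH [seq j <- r | j != i]) => //.
    move=> j cj /=; rewrite mem_filter; apply/andP; split.
      by apply/eqP => ji; apply: nci; rewrite -ji.
    by apply: cr; apply: sub.
  rewrite size_filter; rewrite ltnS in sr; apply: leq_trans sr.
  rewrite -(count_predC (pred1 i)).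
  by rewrite -add1n leq_add2r -has_count has_pred1; apply: cr.
Qed.

End SignVectors.

(** * Nearest points *)

Section EuclideanSpace.
Variables (R : realType) (n : nat).
Local Notation V := 'rV[R]_n.
Implicit Types (x y z v w : V) (K : set V) (t : R).

Lemma dotv_affine v x y t :
  dotv v (x + t *: (y - x)) = dotv v x + t * (dotv v y - dotv v x).
Proof.
rewrite /dotv -sumrB mulr_sumr -big_split /=; apply: eq_bigr => i _.
by rewrite !mxE; ring.
Qed.

Lemma dotvC x y : dotv x y = dotv y x.
Proof. by apply: eq_bigr => i _; rewrite mulrC. Qed.

Lemma dotvDr v x y : dotv v (x + y) = dotv v x + dotv v y.
Proof. by rewrite /dotv -big_split /=; apply: eq_bigr => i _; rewrite mxE mulrDr. Qed.

Lemma dotvZr v t x : dotv v (t *: x) = t * dotv v x.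
Proof. by rewrite /dotv mulr_sumr; apply: eq_bigr => i _; rewrite mxE; ring. Qed.

Lemma dotv_ge0 x : 0 <= dotv x x.
Proof. by apply: sumr_ge0 => i _; rewrite -expr2 sqr_ge0. Qed.

Lemma dotv_eq0 x : dotv x x = 0 -> x = 0.
Proof.
move=> /eqP; rewrite psumr_eq0 => [/allP h|i _]; last by rewrite -expr2 sqr_ge0.
apply/rowP => i; rewrite mxE; apply/eqP.
by have := h i (mem_index_enum i); rewrite mulf_eq0 orbb.
Qed.

Lemma dotv_continuous v : continuous (dotv v).
Proof.
apply: continuous_big => [|i _]; first exact: add_continuous.
move=> x; apply: continuousM; first exact: cst_continuous.
exact: coord_continuous.
Qed.

Definition sqdist x y : R := dotv (x - y) (x - y).

(** Stewart's identity; the subtracted term expresses strict convexity. *)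
Lemma sqdist_affine x z w t : sqdist x (z + t *: (w - z)) =
  (1 - t) * sqdist x z + t * sqdist x w - t * (1 - t) * sqdist z w.
Proof.
rewrite /sqdist /dotv !mulr_sumr -big_split -sumrB /=.
by apply: eq_bigr => i _; rewrite !mxE; ring.
Qed.

Lemma sqdist_ge0 x y : 0 <= sqdist x y. Proof. exact: dotv_ge0. Qed.

Lemma sqdist_eq0 x y : sqdist x y = 0 -> x = y.
Proof. by move=> /dotv_eq0/eqP; rewrite subr_eq0 => /eqP. Qed.

Lemma le_edist x y z : (Defs.edist x y <= Defs.edist x z) = (sqdist x y <= sqdist x z).
Proof. by rewrite /Defs.edist ler_sqrt // dotv_ge0. Qed.

Lemma sqdist_continuous x : continuous (sqdist x).
Proof.
apply: continuous_big => [|i _]; first exact: add_continuous.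
have h : continuous (fun y : V => (x - y) 0 i).
  under eq_fun do rewrite !mxE.
  move=> y; apply: continuousB; first exact: cst_continuous.
  exact: coord_continuous.
by move=> y; apply: continuousM; apply: h.
Qed.

Definition is_convex K := forall x y t, K x -> K y -> 0 <= t <= 1 ->
  K (x + t *: (y - x)).

Definition nearest K x z := K z /\ forall w, K w -> sqdist x z <= sqdist x w.

(** By convexity of the squared distance, one point of [K] on the segment beyond [z] suffices; [w]
    itself may lie outside [K]. *)
Lemma nearest_local K x z w t : 0 < t <= 1 -> nearest K x z ->
  K (z + t *: (w - z)) -> sqdist x z <= sqdist x w.
Proof.
move=> /andP[t0 t1] [_ h] /h; rewrite sqdist_affine => le.
have h0 : 0 <= t * (1 - t) * sqdist z w by rewrite !mulr_ge0 ?sqdist_ge0 ?(ltW t0) // subr_ge0.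
by rewrite -(ler_pM2l t0); lra.
Qed.

Lemma nearest_strict K x z w : is_convex K -> nearest K x z -> K w -> z <> w ->
  sqdist x z < sqdist x w.
Proof.
move=> cK nz Kw ne; have Kz : K z by case: nz.
have d0 : 0 < sqdist z w.
  by rewrite lt_neqAle sqdist_ge0 andbT eq_sym; apply/eqP => /sqdist_eq0.
(* Minimality is tested at the midpoint of [z] and [w]. *)
have h01 : 0 <= (2^-1 : R) <= 1 by apply/andP; split; lra.
have := proj2 nz _ (cK _ _ _ Kz Kw h01); rewrite sqdist_affine; lra.
Qed.

Lemma nearest_uniq K x z w : is_convex K -> nearest K x z -> nearest K x w -> z = w.
Proof.
move=> cK nz [Kw hw]; apply: contrapT => ne.
by have := nearest_strict cK nz Kw ne; rewrite ltNge hw //; case: nz.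
Qed.

Lemma projection_nearest K x z : is_convex K -> nearest K x z -> projection K x = z.
Proof.
move=> cK nz; apply: get_unique.
  by case: nz => Kz h; split=> // w /h; rewrite le_edist.
move=> y [Ky h]; apply: nearest_uniq nz => //; split=> // w /h.
by rewrite le_edist.
Qed.

Lemma edist_set_nearest K x z : nearest K x z -> edist_set x K = Defs.edist x z.
Proof.
move=> [Kz h]; have lb : lbound [set Defs.edist x y | y in K] (Defs.edist x z).
  by move=> _ [w Kw <-]; rewrite le_edist h.
apply/eqP; rewrite eq_le; apply/andP; split.
  by apply: ge_inf; [exists (Defs.edist x z)|exists z].
by apply: lb_le_inf => //; exists (Defs.edist x z), z.
Qed.

Lemma nearest_exists K x : closed K -> K !=set0 -> exists z, nearest K x z.
Proof.
move=> cK [w Kw].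
(* As [M] is at least 1, its square exceeds [sqdist x w], so [M] bounds the coordinate differences
   without a square root. *)
pose M := sqdist x w + 1.
have M1 : 1 <= M by have := sqdist_ge0 x w; rewrite /M; lra.
pose B := [set y : V | forall i, y ord0 i \in `[x 0 i - M, x 0 i + M]].
have cB : compact B.
  apply: (@rV_compact _ _ (fun i => `[x 0 i - M, x 0 i + M]%classic)) => i.
  exact: segment_compact.
pose K' := K `&` [set y | sqdist x y <= sqdist x w].
have cK' : closed K'.
  apply: closedI => //; apply: (@closed_comp _ _ (sqdist x) [set r | r <= sqdist x w]).
    by move=> y _; apply: sqdist_continuous.
  exact: closed_le.
have : compact K'.
  apply: subclosed_compact cK' cB _ => y [_ /= yw] i.
  have h : ((x - y) 0 i) ^+ 2 <= sqdist x w.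
    apply: le_trans yw; rewrite /sqdist /dotv (bigD1 i) //= -expr2 lerDl.
    by apply: sumr_ge0 => j _; rewrite -expr2 sqr_ge0.
  rewrite !mxE in h; rewrite in_itv /=.
  by apply/andP; split; rewrite /M in M1 *; nra.
move=> /(EVT_min_rV _ (f := sqdist x)) [||z].
- by exists w; split=> /=.
- exact/continuous_subspaceT/sqdist_continuous.
rewrite inE => -[Kz /= zw] h; exists z; split=> // v Kv.
case: (leP (sqdist x v) (sqdist x w)) => [vw|/ltW]; last exact: le_trans.
by apply: h; rewrite inE.
Qed.

End EuclideanSpace.

(** * Faces of an arrangement *)

Section ArrangementFaces.
Variables (R : realType) (n : nat).
Local Notation V := 'rV[R]_n.
Implicit Types (x y z c d e f g v w : V) (H C F G K : set V) (t : R).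

(* Junk outside hyperplanes; for [H] in an arrangement, a normal vector and the
   corresponding constant. *)
Definition equation H : V * R :=
  xget (0, 0) [set ab | ab.1 != 0 /\ H = hyperplane ab.1 ab.2].

Definition aff H x : R := dotv (equation H).1 x - (equation H).2.

Lemma aff_affine H x y t : aff H (x + t *: (y - x)) = aff H x + t * (aff H y - aff H x).
Proof. by rewrite /aff dotv_affine; ring. Qed.

Lemma aff_continuous H : continuous (aff H).
Proof.
move=> x; apply: continuousB; last exact: cst_continuous.
exact: dotv_continuous.
Qed.

Lemma equationP H : is_hyperplane H ->
  (equation H).1 != 0 /\ H = hyperplane (equation H).1 (equation H).2.
Proof.
move=> [a [b h]]; apply: (xgetPex (0, 0)
  (P := [set ab : V * R | ab.1 != 0 /\ H = hyperplane ab.1 ab.2])).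
by exists (a, b).
Qed.

Lemma aff_eq0 H x : is_hyperplane H -> H x <-> aff H x = 0.
Proof.
move=> /equationP[_ e]; rewrite {1}e /aff /hyperplane /=; split=> [->|/eqP].
  by rewrite subrr.
by rewrite subr_eq0 => /eqP.
Qed.

(** Vectors orthogonal to [a0] translate [H] into itself, hence are orthogonal to [a]. So
    [a - k *: a0], with [k] chosen to make it orthogonal to [a0], is orthogonal to itself. *)
Lemma aff_scale H a b : is_hyperplane H -> a != 0 -> H = hyperplane a b ->
  exists2 k, k != 0 & forall x, dotv a x - b = k * aff H x.
Proof.
move=> /equationP[]; rewrite /aff; move: (equation H) => -[a0 b0] /= a00 -> a_0 e.
have n0 : dotv a0 a0 != 0 by apply: contra a00 => /eqP/dotv_eq0->.
have in_H x : dotv a0 x = b0 -> dotv a x = b.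
  by move=> h; have : hyperplane a0 b0 x by []; rewrite e.
have pb : dotv a0 ((b0 / dotv a0 a0) *: a0) = b0 by rewrite dotvZr divfK.
have ort v : dotv a0 v = 0 -> dotv a v = 0.
  move=> v0; have := in_H ((b0 / dotv a0 a0) *: a0 + v).
  rewrite !dotvDr pb v0 addr0 (in_H _ pb) => /(_ erefl) h.
  by apply: (addrI b); rewrite h addr0.
pose k := dotv a a0 / dotv a0 a0.
have ak : a = k *: a0.
  apply/eqP; rewrite -subr_eq0; apply/eqP/dotv_eq0; rewrite -scaleNr.
  have h0 : dotv a0 (a + - k *: a0) = 0.
    by rewrite dotvDr dotvZr mulNr divfK // dotvC subrr.
  by rewrite dotvDr dotvZr dotvC (ort _ h0) dotvC h0 mulr0 addr0.
exists k => [|x]; first by apply: contra a_0 => /eqP k0; rewrite ak k0 scale0r.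
have E y : dotv a y = k * dotv a0 y by rewrite {1}ak dotvC dotvZr dotvC.
by rewrite -(in_H _ pb) !E pb; ring.
Qed.

Variable A : set (set V).
Hypothesis hA : arrangement A.
Hypothesis hlf : locally_finite A.
Local Notation leS := (fle A aff).
Local Notation eqS := (same A aff).
Local Notation s H x := (Num.sg (aff H x)).

Lemma line_continuous x v : continuous (fun t : R => x + t *: v).
Proof. by move=> t; apply: cvgD; [exact: cvg_cst|exact: scalel_continuous]. Qed.

(** The segment is compact, so finitely many of the neighbourhoods given by local finiteness cover
    it. *)
Lemma aff_finite x y :
  finite_set [set H | A H /\ exists2 t, 0 <= t <= 1 & aff H (x + t *: (y - x)) = 0].
Proof.
pose U x := sval (cid2 (hlf x)).
have nU z : nbhs z (U z) by rewrite /U; case: cid2.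
have fU z : finite_set [set H | A H /\ H `&` U z !=set0] by rewrite /U; case: cid2.
pose S := [set x + t *: (y - x) | t in `[(0 : R), 1]].
have : compact S.
  apply: continuous_compact; last exact: segment_compact.
  exact/continuous_subspaceT/line_continuous.
rewrite compact_cover => /(_ V setT (fun z => (U z)°)) [||D _ SD].
- by move=> i _; apply: open_interior.
- by move=> z _; exists z => //; apply: nbhs_singleton; apply: nbhs_interior.
apply: sub_finite_set (bigcup_finite (finite_fset D) (fun z _ => fU z)).
move=> H [AH [t t01 h0]]; have : S (x + t *: (y - x)) by exists t.
move=> /SD[z Dz Uz]; exists z => //; split=> //.
exists (x + t *: (y - x)); split; last exact: interior_subset Uz.
by apply/aff_eq0 => //; apply: hA.
Qed.

Local Notation finA := aff_finite.
Local Notation affA := aff_affine.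

(** * Faces as closed strata *)

Definition face_at x := [set y | leS y x].

Lemma face_at_self x : face_at x x.
Proof. exact: fle_refl. Qed.

Lemma face_at_sub x y : face_at x `<=` face_at y <-> leS x y.
Proof.
split=> [h|xy z zx]; first by apply: h; apply: face_at_self.
exact: fle_trans zx xy.
Qed.

Lemma face_at_eq x y : face_at x = face_at y <-> eqS x y.
Proof.
split=> [e|e].
  by apply: fle_anti; apply/face_at_sub; rewrite e.
by apply/seteqP; split; apply/face_at_sub/same_fle => //; apply: same_sym.
Qed.

Lemma same_stratumP x y : same_stratum A x y <-> eqS x y.
Proof.
split=> [h H AH|h H AH].
  case: (h H AH) => [[Hx Hy]|[a [b [a0 e]]]].
    by rewrite (proj1 (aff_eq0 _ (hA AH)) Hx) (proj1 (aff_eq0 _ (hA AH)) Hy).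
  have [k k0 hk] := aff_scale (hA AH) a0 e.
  (* The factor [k] occurs twice, and its square does not affect the sign. *)
  rewrite !hk mulrACA -sgr_gt0 sgrM -expr2 sgrX sqr_sg k0 mul1r sgrM.
  case: (sgr_cases (aff H x)) => -[_ ->]; case: (sgr_cases (aff H y)) => -[_ ->] //;
    by rewrite ?mulr0 ?mul0r ?mulr1 ?mul1r ?ltxx ?ltr0N1.
have hH := hA AH; have := h H AH.
case: (eqVneq (aff H x) 0) => [x0|x0 e].
  rewrite x0 sgr0 => /esym/sgl_eq0 y0; left.
  by split; apply/aff_eq0.
right; have [a0 eH] := equationP hH; exists (equation H).1, (equation H).2.
split=> //; rewrite -/(aff H x) -/(aff H y) -sgr_gt0 sgrM -e -expr2 sqr_sg x0.
exact: ltr01.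
Qed.

Lemma closed_side H x : closed [set y | aff H y = 0 \/ s H y = s H x].
Proof.
have cl (D : set R) : closed D -> closed (aff H @^-1` D).
  by apply: closed_comp => y _; apply: aff_continuous.
case: (sgr_cases (aff H x)) => -[hx ->].
- rewrite (_ : mkset _ = aff H @^-1` [set r | r <= 0]); first by apply: cl; exact: closed_le.
  apply/seteqP; split=> y /=; case: (sgr_cases (aff H y)) => -[h ->].
  + by move=> _; apply: ltW.
  + by move=> _; rewrite h.
  + by case=> e; exfalso; lra.
  + by right.
  + by left.
  + by move=> e; exfalso; lra.
- rewrite (_ : mkset _ = aff H @^-1` [set 0]); first by apply: cl; exact: closed_eq.
  by apply/seteqP; split=> y /=; [case=> // /eqP; rewrite sgr_eq0 => /eqP|left].
- rewrite (_ : mkset _ = aff H @^-1` [set r | 0 <= r]); first by apply: cl; exact: closed_ge.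
  apply/seteqP; split=> y /=; case: (sgr_cases (aff H y)) => -[h ->].
  + by case=> e; exfalso; lra.
  + by move=> _; rewrite h.
  + by move=> _; apply: ltW.
  + by move=> e; exfalso; lra.
  + by left.
  + by right.
Qed.

(* For [B = A] this is a face; for smaller [B], a chamber of a subarrangement. *)
Definition cone (B : set (set V)) x :=
  [set y | forall H, A H -> B H -> aff H y = 0 \/ s H y = s H x].

Lemma closed_cone B x : closed (cone B x).
Proof.
rewrite (_ : cone B x = \bigcap_(H in A `&` B) [set y | aff H y = 0 \/ s H y = s H x]).
  by apply: closed_bigI => H _; apply: closed_side.
apply/seteqP; split=> y h H => [[AH BH]|AH BH]; first exact: h.
exact: (h H (conj AH BH)).
Qed.

Lemma sgr_conv (a b k : R) t : 0 <= t <= 1 -> a = 0 \/ Num.sg a = Num.sg k ->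
  b = 0 \/ Num.sg b = Num.sg k -> a + t * (b - a) = 0 \/ Num.sg (a + t * (b - a)) = Num.sg k.
Proof.
move=> /andP[t0 t1] ha hb.
have ha' : 0 <= a * k.
  by case: ha => [->|e]; rewrite ?mul0r // -sgr_ge0 sgrM e -expr2 sqr_ge0.
have hb' : 0 <= b * k.
  by case: hb => [->|e]; rewrite ?mul0r // -sgr_ge0 sgrM e -expr2 sqr_ge0.
case: (eqVneq k 0) ha hb => [->|k0 _ _].
  rewrite sgr0 => -[->|/eqP]; last rewrite sgr_eq0 => /eqP ->.
    by move=> [->|/eqP]; [left|rewrite sgr_eq0 => /eqP->; left]; ring.
  by move=> [->|/eqP]; [left|rewrite sgr_eq0 => /eqP->; left]; ring.
have : 0 <= (a + t * (b - a)) * k.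
  rewrite (_ : _ * k = (1 - t) * (a * k) + t * (b * k)); last by ring.
  by rewrite addr_ge0 // mulr_ge0 // subr_ge0.
move: (a + _) => r; rewrite -sgr_ge0 sgrM.
case: (sgr_cases r) => -[hr ->]; first last; try (by left);
  case: (sgr_cases k) => -[hk ->] p; try (by right); try (by rewrite hk eqxx in k0);
  exfalso; lra.
Qed.

Lemma convex_cone B x : is_convex (cone B x).
Proof.
move=> y z t hy hz t01 H AH BH; rewrite affA.
by apply: sgr_conv => //; [apply: hy|apply: hz].
Qed.

Lemma face_at_cone x : face_at x = cone setT x.
Proof. by apply/seteqP; split=> y h H AH => [_|]; apply: h. Qed.

Lemma closed_face_at x : closed (face_at x).
Proof. by rewrite face_at_cone; apply: closed_cone. Qed.

Lemma convex_face_at x : is_convex (face_at x).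
Proof. by rewrite face_at_cone; apply: convex_cone. Qed.

Lemma ray_nbhs y v (B : set V) : nbhs y B -> exists2 t, 0 < t <= 1 & B (y + t *: v).
Proof.
move=> nB; have : nbhs (0 : R) [set t | B (y + t *: v)].
  by apply: (line_continuous (x := y) (v := v)); rewrite scale0r addr0.
move=> /nbhs_ballP[e /= e0 he]; exists (Num.min (e / 2) 1).
  by rewrite lt_min ltr01 ge_min lexx orbT divr_gt0.
apply: he; rewrite /ball /= sub0r normrN ger0_norm ?lt_min.
  by rewrite gt_min ltr_pdivrMr //; apply/orP; left; lra.
by rewrite le_min ler01 divr_ge0 // ltW.
Qed.

(** [face_at x] is closed and contains the stratum; conversely, stepping from any of its points
    towards [x] enters the stratum at once. *)
Lemma closure_stratum x : closure [set y | same_stratum A x y] = face_at x.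
Proof.
apply/seteqP; split=> y.
  move: (@closed_face_at x) => /closure_id ->; apply: closure_subset => {}y.
  by move=> /same_stratumP/same_sym/same_fle.
move=> yx B /(ray_nbhs (x - y))[t /andP[t0 t1] Bt]; exists (y + t *: (x - y)).
split=> //; apply/same_stratumP => H AH; rewrite affA.
case: (yx H AH) => [->|e].
  by rewrite subr0 add0r sgrM (gtr0_sg t0) mul1r.
have nz : forall (a b : R), Num.sg a = Num.sg b -> Num.sg b = Num.sg (a + t * (b - a)).
  move=> a b ab; case: (sgr_cases b) ab => -[hb ->] ea; apply/esym.
  - have ha : a < 0 by rewrite -sgr_lt0 ea ltrN10.
    by apply: ltr0_sg; nra.
  - by move/eqP: ea; rewrite sgr_eq0 => /eqP ->; rewrite hb subrr mulr0 addr0 sgr0.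
  - have ha : 0 < a by rewrite -sgr_gt0 ea ltr01.
    by apply: gtr0_sg; nra.
exact: nz.
Qed.

Lemma faceP F : face A F <-> exists x, F = face_at x.
Proof. by split=> -[x ->]; exists x; rewrite closure_stratum. Qed.

(** * Chambers, separation, and the operations [C.F] and [C^F] *)

Definition full c := forall H, A H -> aff H c != 0.

(** A small step in any direction stays in the chamber, so the direction space contains every
    vector. *)
Lemma full_codim0 c : full c -> has_codim (face_at c) 0.
Proof.
move=> fc; exists fullv; last by rewrite dimvf /dim /= addn0 mul1n.
split=> [x y _ _|W hW]; first exact: memvf.
apply/subvP => v _.
have [t [/andP[t0 _] ht]] := push affA finA c (c + v).
have cv : face_at c (c + t *: (c + v - c)).
  by move=> H AH; right; apply: ht => //; apply: fc.
have := hW _ _ cv (face_at_self c); rewrite !(addrC c) addrK addrK => tv.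
have tn0 : t != 0 by rewrite gt_eqF.
by rewrite -[v](scalerK tn0) memvZ.
Qed.

(** If [c] were on a hyperplane with normal [a], the face would be too, and its direction would be
    orthogonal to [a]; full dimension then makes [a] orthogonal to itself. *)
Lemma codim0_full c : has_codim (face_at c) 0 -> full c.
Proof.
move=> [V0 [_ min]]; rewrite addn0 => dV H AH; apply/eqP => c0.
have [a0 _] := equationP (hA AH); set a := (equation H).1 in a0.
have : (V0 <= lker (linfun (mulmxr a^T)))%VS.
  apply: min => x y xc yc; rewrite memv_ker lfunE /=.
  have x0 : aff H x = 0 by apply: (fle0 xc).
  have y0 : aff H y = 0 by apply: (fle0 yc).
  apply/eqP/matrixP => i j; rewrite !ord1 !mxE.
  transitivity (dotv a x - dotv a y).
    by rewrite /dotv -sumrB; apply: eq_bigr => k _; rewrite !mxE; ring.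
  by move: x0 y0; rewrite /aff -/a; lra.
have -> : V0 = fullv.
  by apply/eqP; rewrite eqEdim subvf dimvf /dim /= mul1n dV.
move=> /subvP/(_ a (memvf _)); rewrite memv_ker lfunE /= => /eqP/matrixP/(_ 0 0).
rewrite !mxE => h; move/eqP: a0; apply; apply: dotv_eq0; rewrite -[RHS]h.
by apply: eq_bigr => k _; rewrite mxE.
Qed.

Lemma chamberP C : chamber A C <-> exists2 c, full c & C = face_at c.
Proof.
split=> [[/faceP[c ->] /codim0_full fc]|[c fc ->]]; first by exists c.
by split; [apply/faceP; exists c|apply: full_codim0].
Qed.

Lemma suppE f : supp A (face_at f) = [set H | A H /\ aff H f = 0].
Proof.
apply/seteqP; split=> H [AH h]; split=> //.
  by apply/(aff_eq0 _ (hA AH)); apply: h; apply: face_at_self.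
by move=> x xf; apply/(aff_eq0 _ (hA AH)); apply: (fle0 xf).
Qed.

Lemma full_sg c d H : full c -> full d -> A H -> s H c <> s H d -> s H c = - s H d.
Proof.
move=> fc fd AH; have := fc H AH; have := fd H AH.
case: (sgr_cases (aff H c)) => -[hc ->]; case: (sgr_cases (aff H d)) => -[hd ->];
  rewrite ?hc ?hd ?eqxx ?opprK //.
Qed.

Lemma full_sgN c H : full c -> A H -> s H c <> - s H c.
Proof. by move=> fc AH /sgr_neq_opp h; apply: h; apply: fc. Qed.

Lemma sepE c d : full c -> full d ->
  sep A (face_at c) (face_at d) = [set H | A H /\ s H c = - s H d].
Proof.
move=> fc fd; apply/seteqP; split=> H [AH].
  move=> [a [b [a0 e hc hd]]]; split=> //.
  have [k k0 hk] := aff_scale (hA AH) a0 e.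
  have := hc _ (face_at_self c); have := hd _ (face_at_self d) => /=.
  rewrite -subr_ge0 hk -(subr_le0 b) hk -sgr_ge0 -sgr_le0 !sgrM.
  move: k0 (fc H AH) (fd H AH); rewrite -(sgr_eq0 k) -(sgr_eq0 (aff H c)).
  rewrite -(sgr_eq0 (aff H d)).
  case: (sgr_cases k) => -[_ ->]; case: (sgr_cases (aff H c)) => -[_ ->];
    case: (sgr_cases (aff H d)) => -[_ ->];
    rewrite ?eqxx ?opprK ?mulrN1 ?mulr1 ?opprK ?ler10 ?oppr_ge0 ?ler10 ?ler01 ?lerN10 //.
move=> e; split=> //; have [a0 eH] := equationP (hA AH).
move: a0 eH; set a := (equation H).1; set b := (equation H).2 => a0 eH.
case: (sgr_cases (aff H c)) => -[hc sc].
- exists a, b; split=> // x hx /=.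
    rewrite -subr_le0 -/(aff H x); case: (hx H AH) => [->//|].
    by rewrite sc => ex; rewrite -sgr_le0 ex lerN10.
  rewrite -subr_ge0 -/(aff H x); case: (hx H AH) => [->//|].
  by rewrite -[s H d]opprK -e sc opprK => ex; rewrite -sgr_ge0 ex ler01.
- by have := fc H AH; rewrite hc eqxx.
(* Here [c] is on the positive side, while [sep] wants it on the lower one, so the equation is
   negated. *)
- exists (- a), (- b).
  have nE x : dotv (- a) x - (- b) = - aff H x.
    by rewrite dotvC -scaleN1r dotvZr dotvC /aff -/a -/b; ring.
  split.
  + by rewrite oppr_eq0.
  + rewrite eH; apply/seteqP; split=> x /=; rewrite /hyperplane /= => /eqP h; apply/eqP.
      by rewrite -subr_eq0 nE oppr_eq0 /aff -/a -/b subr_eq0.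
    by move: h; rewrite -subr_eq0 nE oppr_eq0 /aff -/a -/b subr_eq0.
  + move=> x hx /=; rewrite -subr_le0 nE oppr_le0.
    by case: (hx H AH) => [->//|]; rewrite sc => ex; rewrite -sgr_ge0 ex ler01.
  + move=> x hx /=; rewrite -subr_ge0 nE oppr_ge0.
    case: (hx H AH) => [->//|]; rewrite -[s H d]opprK -e sc => ex.
    by rewrite -sgr_le0 ex lerN10.
Qed.

(** For [c] inside a chamber [C] and [F] the face of [f], this represents [C.F]; [fopp f c]
    represents [C^F] when [F] is a face of [C]. *)
Definition fcomp f c : V := sval (cid (composition affA finA f c)).
Definition fopp f c : V := sval (cid (reflection affA finA f c)).

Lemma sg_comp f c H : A H -> s H (fcomp f c) = if aff H f == 0 then s H c else s H f.
Proof. by move=> AH; rewrite /fcomp; case: cid => x /= ->. Qed.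

Lemma sg_opp f c H : A H -> s H (fopp f c) = if aff H f == 0 then - s H c else s H f.
Proof. by move=> AH; rewrite /fopp; case: cid => x /= ->. Qed.

Lemma full_comp f c : full c -> full (fcomp f c).
Proof.
move=> fc H AH; rewrite -sgr_eq0 sg_comp //; case: ifP => [_|/negbT f0].
  by rewrite sgr_eq0 fc.
by rewrite sgr_eq0.
Qed.

Lemma full_opp f c : full c -> full (fopp f c).
Proof.
move=> fc H AH; rewrite -sgr_eq0 sg_opp //; case: ifP => [_|/negbT f0].
  by rewrite oppr_eq0 sgr_eq0 fc.
by rewrite sgr_eq0.
Qed.

Lemma le_comp f c : leS f (fcomp f c).
Proof. by move=> H AH; rewrite sg_comp //; case: eqVneq; [left|right]. Qed.

Lemma le_opp f c : leS f (fopp f c).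
Proof. by move=> H AH; rewrite sg_opp //; case: eqVneq; [left|right]. Qed.

Lemma chamber_dotE f c : full c ->
  chamber_dot A (face_at c) (face_at f) = face_at (fcomp f c).
Proof.
move=> fc; have fcc := full_comp f fc; apply: get_unique.
  split; [by apply/chamberP; exists (fcomp f c)|exact/face_at_sub/le_comp|].
  rewrite suppE sepE //; apply/seteqP; split=> // H [[AH f0] [_]].
  by rewrite sg_comp // f0 eqxx; apply: full_sgN.
move=> _ [/chamberP[d fd ->] /face_at_sub fd_ e]; apply/face_at_eq => H AH.
rewrite sg_comp //; case: eqVneq => [f0|f0].
  apply: contrapT => /(full_sg fd fc AH) h.
  suff : (supp A (face_at f) `&` sep A (face_at c) (face_at d)) H by rewrite e.
  by rewrite suppE sepE //; do !split => //; rewrite h opprK.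
by case: (fd_ H AH) => // h; rewrite h eqxx in f0.
Qed.

Lemma chamber_oppE f c : full c -> leS f c ->
  chamber_opp A (face_at c) (face_at f) = face_at (fopp f c).
Proof.
move=> fc fle_c; have fo := full_opp f fc; apply: get_unique.
  split; [by apply/chamberP; exists (fopp f c)|exact/face_at_sub/le_opp|].
  rewrite suppE sepE //; apply/seteqP; split=> H [AH] /=.
    rewrite sg_opp //; case: eqVneq => // f0.
    case: (fle_c H AH) => [/eqP|->]; first by rewrite (negbTE f0).
    by move=> /(full_sgN fc AH).
  by move=> f0; rewrite sg_opp // f0 eqxx opprK.
move=> _ [/chamberP[d fd ->] /face_at_sub fd_ e]; apply/face_at_eq => H AH.
rewrite sg_opp //; case: eqVneq => [f0|f0].
  have : supp A (face_at f) H by rewrite suppE.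
  by rewrite -e sepE // => -[_ ->]; rewrite opprK.
by case: (fd_ H AH) => // h; rewrite h eqxx in f0.
Qed.

End ArrangementFaces.

(** * Fibers of [eta] *)

Section EuclideanFibers.
Variables (R : realType) (n : nat).
Local Notation V := 'rV[R]_n.
Implicit Types (x y z c d e f g v w : V) (H C D F G K : set V) (t : R).
Variable A : set (set V).
Hypothesis hA : arrangement A.
Hypothesis hlf : locally_finite A.
Local Notation leS := (fle A (@aff R n)).
Local Notation eqS := (same A (@aff R n)).
Local Notation s H x := (Num.sg (aff H x)).
Local Notation face_at := (face_at A).
Local Notation full := (full A).
Local Notation fcomp := (fcomp hA hlf).
Local Notation fopp := (fopp hA hlf).
Local Notation affA := (@aff_affine R n).
Local Notation finA := (aff_finite hA hlf).

Definition through f : set (set V) := [set H | aff H f = 0].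

(** Hyperplanes of [B] through [z] contain [w], and the others leave room for a short step, so a
    step towards [w] stays in the cone even if [w] is outside. *)
Lemma nearest_in_cone B z w d x : nearest (cone A B d) x z ->
  (forall H, A H -> B H -> aff H z = 0 -> aff H w = 0) -> sqdist x z <= sqdist x w.
Proof.
move=> nz hw; have [t [t01 ht]] := push affA finA z w.
apply: (nearest_local t01 nz) => H AH BH; case: (eqVneq (aff H z) 0) => [z0|z0].
  by left; rewrite affA z0 (hw H AH BH z0) subrr mulr0 addr0.
rewrite (ht H AH z0); case: nz => hz _; case: (hz H AH BH) => [/eqP|->]; last by right.
by rewrite (negbTE z0).
Qed.

Variable x0 : V.
Hypothesis gen : generic A x0.

(* Genericity enters only here: the flat cut out by the hyperplanes of [B]
   through [z] is as close to [x0] as the one cut out by all hyperplanes through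
   [z], so the two coincide. *)
Lemma nearest_supp B z d f : nearest (cone A B d) x0 z ->
  (forall H, A H -> B H -> aff H f = 0) ->
  forall H, A H -> aff H z = 0 -> aff H f = 0.
Proof.
move=> nz hf.
pose L := \bigcap_(H in [set H | [/\ A H, B H & aff H z = 0]]) H.
pose L' := \bigcap_(H in [set H | A H /\ aff H z = 0]) H.
have L'L : L' `<=` L by move=> w h H [AH _ z0]; apply: h.
have zL' : L' z by move=> H [AH z0]; apply/(aff_eq0 _ (hA AH)).
have nL : nearest L x0 z.
  split=> [|w hw]; first exact: L'L.
  apply: nearest_in_cone nz _ => H AH BH z0.
  by apply/(aff_eq0 _ (hA AH)); apply: hw.
have nL' : nearest L' x0 z.
  by split=> // w /L'L; case: nL => _; apply.
have fL : flat A L.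
  by split; [exists z; apply: L'L|exists [set H | [/\ A H, B H & aff H z = 0]] => // H []].
have fL' : flat A L'.
  by split; [exists z|exists [set H | A H /\ aff H z = 0] => // H []].
have LL' : L `<=` L'.
  apply: contrapT => nLL; have : L' `<` L by [].
  move/(proj2 gen _ _ fL fL').
  by rewrite (edist_set_nearest nL) (edist_set_nearest nL') ltxx.
move=> H AH z0; apply/(aff_eq0 _ (hA AH)); apply: (LL' f) => // H' [AH' BH' _].
by apply/(aff_eq0 _ (hA AH')); apply: hf.
Qed.

(** Here [face_at z] is the face [F_C] of the chamber of [c]; see [smallest_face_base]. *)
Definition base c z := full c /\ nearest (face_at c) x0 z.

Lemma base_le c z : base c z -> leS z c.
Proof. by case=> _ []. Qed.

Lemma base_exists c : full c -> exists z, base c z.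
Proof.
move=> fc; have [|z nz] := nearest_exists x0 (@closed_face_at _ _ A c).
  by exists c; apply: face_at_self.
by exists z.
Qed.

Lemma base_sg c z H : base c z -> A H -> aff H z <> 0 -> s H z = s H c.
Proof. by move=> /base_le zc AH z0; case: (zc H AH). Qed.

(** The discarded hyperplanes do not pass through [z], so they do not constrain short steps from
    [z]. *)
Lemma base_nearest_cone c z f : base c z ->
  (forall H, A H -> aff H z = 0 -> aff H f = 0) -> nearest (cone A (through f) c) x0 z.
Proof.
move=> bz zf; case: (bz) => _ nz; split=> [H AH _|w hw]; first exact: base_le bz H AH.
have [t [t01 ht]] := push affA finA z w; case/andP: (t01) => t0 _.
apply: (nearest_local t01 nz) => H AH.
case: (pselect (aff H z = 0)) => [z0|z0]; last first.
  by right; rewrite ht //; [apply: base_sg bz _ _|apply/eqP].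
case: (hw H AH (zf H AH z0)) => [w0|e].
  by left; rewrite affA z0 w0 subrr mulr0 addr0.
by right; rewrite (sg_push affA).
Qed.

(** The description of [N(C)]: the face of [f] lies in the affine hull of [F_C]. *)
Definition based c z f := base c z /\ forall H, A H -> aff H z = 0 -> aff H f = 0.

(** Take [z] nearest to [x0] in the cone cut out by the sides of [d] on the hyperplanes through [f],
    and let [c] be the chamber at [z] on the side of [d]. Genericity puts [f] on every hyperplane
    through [z]. *)
Lemma based_exists d f : full d -> leS f d ->
  exists c z, based c z f /\ eqS (fcomp f c) d.
Proof.
move=> fd fle_d; have [|z nz] := nearest_exists x0 (@closed_cone _ _ A (through f) d).
  by exists d => H AH _; right.
have zd : forall H, A H -> aff H f = 0 -> s H (fcomp z d) = s H d.
  move=> H AH f0; rewrite sg_comp //; case: eqVneq => // z0.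
  by case: nz => hz _; case: (hz H AH f0) => // h; rewrite h eqxx in z0.
exists (fcomp z d), z; split.
  split.
    split; first exact: full_comp.
    split=> [|w hw]; first exact: le_comp.
    case: nz => _; apply=> H AH f0; rewrite -zd //; exact: hw.
  by apply: (nearest_supp nz).
move=> H AH; rewrite sg_comp //; case: eqVneq => [f0|f0]; first exact: zd.
by case: (fle_d H AH) => // h; rewrite h eqxx in f0.
Qed.

Lemma salP p : Sal A p <->
  exists d f, [/\ full d, leS f d & p = (face_at d, face_at f)].
Proof.
case: p => D F; split=> [[/= /(chamberP hA hlf)[d fd ->] /(faceP hA)[f ->]]|].
  by move=> /face_at_sub fle_d; exists d, f.
move=> [d [f [fd fle_d [-> ->]]]]; split=> /=.
- by apply/(chamberP hA hlf); exists d.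
- by apply/(faceP hA); exists f.
- exact/face_at_sub.
Qed.

Lemma sal_based p : Sal A p ->
  exists c z f, based c z f /\ p = (face_at (fcomp f c), face_at f).
Proof.
move=> /salP[d [f [fd fle_d ->]]]; have [c [z [b e]]] := based_exists fd fle_d.
by exists c, z, f; split=> //; congr pair; apply/face_at_eq/same_sym.
Qed.

Lemma based_sal c z f : based c z f -> Sal A (face_at (fcomp f c), face_at f).
Proof.
move=> [[fc _] _]; apply/salP; exists (fcomp f c), f.
by split=> //; [apply: full_comp|apply: le_comp].
Qed.

(** * The sets [N(C)] and the map [eta] *)

Variable ord : set V -> set V -> Prop.
Hypothesis eord : euclidean_order A x0 ord.

Lemma chamber_face_at c : full c -> chamber A (face_at c).
Proof. by move=> fc; apply/(chamberP hA hlf); exists c. Qed.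

Lemma ord_irr c : full c -> ~ ord (face_at c) (face_at c).
Proof. by case: eord => -[h _ _] _ _ /chamber_face_at; apply: h. Qed.

(** If an earlier [c'] also produced this cell, it would agree with [c] on the hyperplanes through
    [f]. Its nearest point would lie in the cone where [z] is uniquely nearest, hence equal [z], and
    then [c'] and [c] agree off [z] as well. *)
Lemma based_N c z f : based c z f ->
  Sal_N A ord (face_at c) (face_at (fcomp f c), face_at f).
Proof.
move=> b; case: (b) => bz zf; case: (bz) => fc nz.
split; first by split; [exact: based_sal b|rewrite /= chamber_dotE].
move=> _ /(chamberP hA hlf)[c' fc' ->] cc' [_ /=].
rewrite (chamber_dotE hA hlf _ fc') => /face_at_eq e.
have cE H : A H -> aff H f = 0 -> s H c' = s H c.
  by move=> AH f0; have := e H AH; rewrite !sg_comp // f0 eqxx.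
have [z' [_ nz']] := base_exists fc'.
have z'K : cone A (through f) c z' by move=> H AH f0; rewrite -cE //; case: nz' => + _; apply.
have := base_nearest_cone bz zf => nK.
have le : sqdist x0 z' <= sqdist x0 z.
  case: eord => _ _ /(_ _ _ (chamber_face_at fc') (chamber_face_at fc) cc').
  by rewrite (edist_set_nearest nz') (edist_set_nearest nz) le_edist.
have zz' : z = z'.
  apply: contrapT => ne; have := nearest_strict (@convex_cone _ _ A _ _) nK z'K ne.
  by rewrite ltNge le.
move: cc'; rewrite (_ : face_at c' = face_at c); first exact: ord_irr.
apply/face_at_eq => H AH; case: (pselect (aff H z = 0)) => [z0|z0].
  by apply: cE => //; apply: zf.
by rewrite -(base_sg bz AH z0); apply/esym; apply: (base_sg _ AH z0); rewrite zz'.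
Qed.

Lemma eta_based c z f : based c z f ->
  eta A ord (face_at (fcomp f c), face_at f) = (face_at c, face_at (fopp f c)).
Proof.
move=> b; have [[fc _] _] := b; have [NS Nmin] := based_N b.
(* [C] and [C.F] agree on the hyperplanes through [F], so reflecting either across [F] gives the
   same chamber. *)
congr pair; last first.
  rewrite /= chamber_oppE //; last exact: le_comp; last exact: full_comp.
  apply/face_at_eq => H AH; rewrite !sg_opp // sg_comp //.
  by case: eqVneq.
apply: get_unique; first by split; [apply: chamber_face_at|apply: based_N b].
move=> C [hC [CS Cmin]]; case: eord => -[_ _ tot] _ _.
case: (tot C (face_at c) hC (chamber_face_at fc)) => // h.
  by case: (Nmin C hC h).
by case: (Cmin _ (chamber_face_at fc) h).
Qed.

Lemma eta_chambers p : Sal A p -> (chamber A `*` chamber A) (eta A ord p).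
Proof.
move=> /sal_based[c [z [f [b ->]]]]; rewrite (eta_based b); have [[fc _] _] := b.
by split; apply: chamber_face_at => //; apply: full_opp.
Qed.

(** The lower cell [p] also lies in [S(C')], so [C'] cannot precede [C]. For the second coordinates:
    hyperplanes through the smaller face all separate [C'] from its opposite, and on the others both
    opposite chambers have the sign of that face. *)
Lemma eta_lt p q : Sal A p -> Sal A q -> Sal_lt A p q ->
  pair_le A ord (eta A ord p) (eta A ord q).
Proof.
move=> /sal_based[c [z [f [b ->]]]] /sal_based[c' [z' [g [b' ->]]]] [/=].
have [[fc _] _] := b; have [[fc' _] _] := b'.
move=> [/face_at_sub gf _]; rewrite (chamber_dotE _ _ _ (full_comp _ _ g fc')).
move=> /face_at_eq e.
have fg H : A H -> aff H f = 0 -> aff H g = 0 by move=> AH; apply: (fle0 gf).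
rewrite (eta_based b) (eta_based b'); apply: t_step; split=> /=.
- by split; apply: chamber_face_at => //; apply: full_opp.
- by split; apply: chamber_face_at => //; apply: full_opp.
- case: eord => -[_ _ tot] _ _.
  case: (tot _ _ (chamber_face_at fc) (chamber_face_at fc')); [by left|by right|].
  move=> h; case: (based_N b) => _ /(_ _ (chamber_face_at fc') h) [].
  split; first exact: based_sal b.
  rewrite /= chamber_dotE //; apply/face_at_eq => H AH.
  rewrite -(e H AH) !sg_comp //; case: eqVneq => // f0.
  by rewrite fg // eqxx.
- have fo := full_opp hA hlf f fc; have fo' := full_opp hA hlf g fc'.
  rewrite /chamber_le !sepE // => H [AH h]; split=> //; rewrite sg_opp //.
  case: (eqVneq (aff H g) 0) => [g0|g0]; first by rewrite opprK.
  have f0 : aff H f != 0 by apply: contra g0 => /eqP/(fg H AH)->.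
  move: h; rewrite sg_opp // (negbTE f0) => ->.
  by case: (gf H AH) => [/eqP|->] //; rewrite (negbTE g0).
Qed.

(** * Fibers as sets of visible faces *)

Definition fiber u : set V :=
  [set f | exists2 D, Sal A (D, face_at f) & eta A ord (D, face_at f) = u].

Lemma opp_eq0 f z H : A H -> aff H (fopp f z) = 0 -> aff H z = 0.
Proof.
move=> AH /sgl_eq0; rewrite sg_opp //; case: eqVneq => f0.
  by move=> /eqP; rewrite oppr_eq0 sgr_eq0 => /eqP.
by move=> /eqP; rewrite sgr_eq0 (negbTE f0).
Qed.

(** The point [fopp f z] lies in the flat of [z], and off the hyperplanes through [z] it has the
    signs of [fopp f c]. Visibility of [f'] says that reflecting [c] across [f'] reaches the same
    chamber as reflecting across [f]. *)
Lemma fiber_visible c z f : based c z f ->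
  fiber (face_at c, face_at (fopp f c)) = visible A (@aff R n) (fopp f z) z.
Proof.
move=> b; have [bz zf] := b; have [fc nz] := bz.
have zc H : A H -> aff H z <> 0 -> s H z = s H c by apply: base_sg bz.
apply/seteqP; split=> f'.
  move=> [D /sal_based[c' [z' [f1 [b1 e1]]]]]; move: (b1) => [[_ nz'] zf'].
  rewrite e1 (eta_based b1) => -[cc oo]; move: e1 => -[_ /face_at_eq f1f'].
  have zz : z' = z.
    by rewrite cc in nz'; apply: nearest_uniq nz' nz; apply: convex_face_at.
  subst z'; move/face_at_eq: cc => cc; move/face_at_eq: oo => oo.
  apply: (visible_same (same_sym f1f')).
  have le1 : leS f1 (fopp f c).
    by apply: fle_trans (le_opp hA hlf f1 c') (same_fle _).
  have qsg H : A H -> aff H (fopp f z) <> 0 -> s H (fopp f z) = s H (fopp f c).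
    move=> AH /sgl_eq0 q0; move: q0; rewrite !sg_opp //; case: eqVneq => // f0 q0.
    by rewrite zc // => z0; apply: q0; rewrite z0 sgr0 oppr0.
  split=> H AH.
    case: (pselect (aff H (fopp f z) = 0)) => [/(opp_eq0 AH)/(zf' H AH)|q0]; first by left.
    by rewrite qsg //; apply: le1.
  move=> f10 /eqP q0; rewrite qsg // -(oo H AH) sg_opp // f10 eqxx opprK (cc H AH).
  by apply: zc => // z0; apply: q0; apply/sgl_eq0; rewrite sg_opp // z0 sgr0 oppr0
     zf // eqxx.
move=> [f'q hf'].
have zf' H : A H -> aff H z = 0 -> aff H f' = 0.
  move=> AH z0; apply: (fle0 f'q) => //; apply/sgl_eq0.
  by rewrite sg_opp // zf // eqxx z0 sgr0 oppr0.
have b' : based c z f' by split.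
exists (face_at (fcomp f' c)); first exact: based_sal b'.
rewrite (eta_based b'); congr pair; apply/face_at_eq => H AH; rewrite !sg_opp //.
case: (eqVneq (aff H f) 0) => [f0|f0].
  case: eqVneq => // f'0; case: (f'q H AH) => [h|->]; first by rewrite h eqxx in f'0.
  rewrite sg_opp // f0 eqxx zc // => z0; move/eqP: f'0; apply; exact: zf'.
have q0 : aff H (fopp f z) != 0 by rewrite -sgr_eq0 sg_opp // (negbTE f0) sgr_eq0.
have z0 : aff H z <> 0 by move=> z0; rewrite zf // eqxx in f0.
case: eqVneq => [f'0|f'0].
  by have := hf' H AH f'0 q0; rewrite sg_opp // (negbTE f0) -zc // => ->; rewrite opprK.
case: (f'q H AH) => [h|->]; first by rewrite h eqxx in f'0.
by rewrite sg_opp // (negbTE f0).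
Qed.

(** If nothing separates [z] from the top of the fiber, both lie in one stratum and no smaller face
    is visible; otherwise the line shelling applies. Empty fibers carry a trivial potential. *)
Lemma fiber_dichotomy u : (exists c z, [/\ base c z, u.1 = face_at c &
    forall f, fiber u f -> eqS f z]) \/
  exists phi, matching_potential A (@aff R n) (fiber u) phi.
Proof.
case: (pselect (fiber u !=set0)) => [[f0 [D]]|no]; last first.
  right; exists (fun=> [::]).
  by split=> [f g hf|f hf]; case: no; exists f.
move=> /sal_based[c [z [f [b ->]]]]; rewrite (eta_based b) => <- {D f0}.
have [bz zf] := b; rewrite (fiber_visible b).
case: (pselect (crossed A (@aff R n) (fopp f z) z !=set0)) => [ne|no].
  right; apply: (visible_potential affA finA) ne => H AH.
  exact: opp_eq0.
left; exists c, z; split=> // f' [f'q hf'] H AH.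
have nc : forall H, A H -> aff H (fopp f z) != 0 -> s H z <> - s H (fopp f z).
  by move=> H' AH' q0 e; apply: no; exists H'.
have zq : s H z = s H (fopp f z).
  case: (pselect (aff H z = 0)) => [z0|/eqP z0].
    by rewrite sg_opp // zf // eqxx z0 sgr0 oppr0.
  have q0 : aff H (fopp f z) != 0.
    rewrite -sgr_eq0 sg_opp //; case: (eqVneq (aff H f) 0) => f0; last by rewrite sgr_eq0.
    by rewrite oppr_eq0 sgr_eq0.
  have := nc H AH q0; move: q0 z0.
  case: (sgr_cases (aff H z)) => -[hz ->]; case: (sgr_cases (aff H (fopp f z))) => -[hq ->];
    by rewrite ?hz ?hq ?eqxx ?opprK.
rewrite zq; case: (eqVneq (aff H (fopp f z)) 0) => [q0|q0].
  by rewrite q0 (fle0 f'q AH q0).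
by case: (f'q H AH) => // h; case: (nc H AH q0); apply: hf'.
Qed.

(** Reflecting [z] across its own face does not move its stratum, so nothing is crossed. *)
Lemma fiber_critical c z : base c z ->
  based c z z /\ forall f, fiber (face_at c, face_at (fopp z c)) f -> eqS f z.
Proof.
move=> bz; have b : based c z z by split.
split=> // f; rewrite (fiber_visible b) => -[fq hf].
have qz : eqS (fopp z z) z.
  by move=> H AH; rewrite sg_opp //; case: eqVneq => // ->; rewrite sgr0 oppr0.
apply: same_trans (qz); apply: fle_anti => // H AH.
case: (fq H AH) => [f0|->]; last by right.
case: (eqVneq (aff H (fopp z z)) 0) => [|q0]; [by left|exfalso].
have := hf H AH f0 q0; rewrite -qz // => /sgr_neq_opp; apply.
exact: q0.
Qed.

Lemma fiber_cell D D' f : Sal A (D, face_at f) -> Sal A (D', face_at f) ->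
  eta A ord (D, face_at f) = eta A ord (D', face_at f) -> D = D'.
Proof.
move=> /sal_based[c [z [g [b e]]]] /sal_based[c' [z' [g' [b' e']]]].
rewrite e e' (eta_based b) (eta_based b') => -[cc _].
move: e e' => [-> /face_at_eq fg] [-> /face_at_eq fg'].
apply/face_at_eq => H AH; rewrite !sg_comp // -(sgr_eq0 (aff H g)) -(sgr_eq0 (aff H g')).
by rewrite -fg // -fg' //; move/face_at_eq: cc => ->.
Qed.

(** Since [(C.G).F = C.F] for [G] inside [F], the cell order within a fiber reduces to inclusion of
    faces. *)
Lemma fiber_comp p q : Sal A p -> Sal A q -> eta A ord p = eta A ord q ->
  q.2 `<=` p.2 -> chamber_dot A q.1 p.2 = p.1.
Proof.
move=> /sal_based[c [z [f [b ->]]]] /sal_based[c' [z' [g [b' ->]]]].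
rewrite (eta_based b) (eta_based b') => -[/face_at_eq cc _] /= /face_at_sub gf.
have [[fc' _] _] := b'.
rewrite chamber_dotE; last exact: full_comp.
apply/face_at_eq => H AH; rewrite !sg_comp //; case: eqVneq => // f0.
by rewrite (fle0 gf AH f0) eqxx cc.
Qed.

(** One strict step in the first coordinate makes the whole chain strict there; otherwise the
    inclusions of separating sets compose. *)
Lemma pair_leE (u v : set V * set V) : pair_le A ord u v ->
  [/\ (chamber A `*` chamber A) u, (chamber A `*` chamber A) v &
      u.1 = v.1 /\ chamber_le A u.1 u.2 v.2 \/ ord u.1 v.1].
Proof.
elim=> {u v} [u v [cu cv [e|h] le]|u v w _ [cu cv uv] _ [_ cw vw]].
- by split=> //; left; rewrite e.
- by split=> //; right.
- split=> //; case: uv vw => [[e le]|h] [[e' le']|h'].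
  + by left; split; [rewrite e|rewrite -e in le'; apply: subset_trans le le'].
  + by right; rewrite e.
  + by right; rewrite -e'.
  + right; case: eord => -[_ tr _] _ _; apply: tr h h'; [by case: cu|by case: cv|by case: cw].
Qed.

(** A chamber is determined by the hyperplanes separating it from a fixed chamber. *)
Lemma pair_le_anti (u v : set V * set V) : pair_le A ord u v -> pair_le A ord v u -> u = v.
Proof.
move=> /pair_leE[[cu1 cu2] [cv1 cv2] uv] /pair_leE[_ _ vu].
have irr a b : chamber A a -> chamber A b -> ord a b -> ord b a -> False.
  move=> ca cb ab ba; case: eord => -[ir tr _] _ _.
  by apply: (ir a ca); apply: tr ab ba.
case: uv vu => [[e le]|h] [[e' le']|h'].
- case: u v cu1 cu2 cv1 cv2 e e' le le' => [a b] [a' b'] /= ca cb _ cb' e _.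
  move: e ca => <- /(chamberP hA hlf)[c fc ->] {a'} le le'; congr pair.
  move: cb cb' le le' => /(chamberP hA hlf)[d fd ->] /(chamberP hA hlf)[d' fd' ->].
  rewrite /chamber_le !sepE // => le le'; apply/face_at_eq => H AH.
  case: (pselect (s H c = - s H d)) => [h|h].
    have [_ h'] := le H (conj AH h); by apply: oppr_inj; rewrite -h.
  case: (pselect (s H c = - s H d')) => [h'|h'].
    by case: h; case: (le' H (conj AH h')).
  have E x : full x -> s H c <> - s H x -> s H x = s H c.
    move=> fx ne; apply: contrapT => /(full_sg fx fc AH) k; apply: ne.
    by rewrite k opprK.
  by rewrite (E d) // (E d').
- by rewrite e in h'; case: (irr v.1 v.1).
- by rewrite e' in h; case: (irr u.1 u.1).
- by case: (irr u.1 v.1).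
Qed.

Lemma smallest_face_base c z : base c z ->
  smallest_face A (face_at c) (projection (face_at c) x0) = face_at z.
Proof.
move=> bz; have [fc nz] := bz.
rewrite (projection_nearest (@convex_face_at _ _ A c) nz).
have zc : face_at z `<=` face_at c by apply/face_at_sub; apply: base_le bz.
have fz : face A (face_at z) by apply/(faceP hA); exists z.
have min G : face A G -> G z -> face_at z `<=` G.
  by move=> /(faceP hA)[g ->] zg; apply/face_at_sub.
apply: get_unique; first by split=> // [|G fG _]; [exact: face_at_self|exact: min].
move=> G [fG Gc Gz h]; apply/seteqP; split; last exact: min.
by apply: h => //; apply: face_at_self.
Qed.

End EuclideanFibers.

(** * The matching *)

Section AcyclicMatching.
Variables (T : Type) (P : set T) (lt : T -> T -> Prop) (pre : T -> T -> Prop).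
Variable M : set (T * T).

(* Every edge on a directed cycle joins [pre]-equivalent elements, hence is a
   reversed edge of the matching, but two of those are never consecutive. *)
Lemma acyclic_potential :
  (forall p q r, pre p q -> pre q r -> pre p r) ->
  (forall p, P p -> ~ lt p p) ->
  (forall p q, P p -> P q -> lt p q -> ~ lt q p) ->
  (forall p q, covers P lt q p -> pre q p) ->
  (forall p q, M (p, q) -> pre p q) ->
  (forall p q, P p -> P q -> pre p q -> pre q p -> [\/ p = q, M (p, q) | M (q, p)]) ->
  matching P lt M -> acyclic P lt M.
Proof.
move=> tr irr asym cov mat cmp [ME uniqM].
have edge_pre p q : oriented_edge P lt M p q -> pre q p.
  by case=> [[/cov]|[_ /mat]].
have path_pre p q : clos_trans _ (oriented_edge P lt M) p q -> pre q p.
  by elim=> {p q} [p q /edge_pre|p q r _ pq _ qr] //; apply: tr qr pq.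
have up p q : oriented_edge P lt M p q -> pre p q -> M (q, p).
  move=> pq h; have := edge_pre _ _ pq; case: pq => [[c nM]|[]//] h'.
  have [/= Pq Pp qp _] := c; case: (cmp p q Pp Pq h h') => // e.
  by move: qp; rewrite e => /irr; case.
move=> p cyc.
have first x y : clos_trans _ (oriented_edge P lt M) x y ->
    exists2 w, oriented_edge P lt M x w & w = y \/ clos_trans _ (oriented_edge P lt M) w y.
  elim=> {x y} [x y xy|x y w xy [u xu uy] yw _]; first by exists y => //; left.
  exists u => //; right; case: uy => [->//|uy]; exact: t_trans uy yw.
have stop q : oriented_edge P lt M p q -> clos_trans _ (oriented_edge P lt M) q p -> False.
  move=> pq qp; have Mqp := up _ _ pq (path_pre _ _ qp).
  have [r qr rp] := first _ _ qp.
  have Mrq : M (r, q).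
    apply: up qr _; case: rp => [->|rp]; first exact: edge_pre.
    by apply: tr (edge_pre _ _ pq) _; exact: path_pre.
  (* Both matching edges contain [q], so they coincide and force [p = q]. *)
  have [] : (q, p) = (r, q) by apply: (uniqM q) => //; [left|right].
  by move=> _ e; have [_ /= Pq + _] := ME _ Mqp; rewrite e; apply: irr.
have [q pq [e|qp]] := first _ _ cyc; last exact: stop qp.
by rewrite e in pq; apply: stop pq (t_step _ _ _ _ pq).
Qed.

End AcyclicMatching.

(** * Assembly of the fiberwise matchings *)

Section EuclideanMatching.
Variables (R : realType) (n : nat).
Local Notation V := 'rV[R]_n.
Local Notation cell := (set V * set V)%type.
Implicit Types (x y z c d e f g v w : V) (H C D F G K : set V) (p q r : cell).
Variable A : set (set V).
Hypothesis hA : arrangement A.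
Hypothesis hlf : locally_finite A.
Variable x0 : V.
Hypothesis gen : generic A x0.
Local Notation leS := (fle A (@aff R n)).
Local Notation eqS := (same A (@aff R n)).
Local Notation face_at := (face_at A).

Definition rep F : V := xget 0 [set x | F = face_at x].

Lemma repE f : face_at (rep (face_at f)) = face_at f.
Proof.
by apply/esym; apply: (xgetPex 0 (P := [set x | face_at f = face_at x])); exists f.
Qed.

(* Ties in the distance are broken by the coordinates of a representative point. *)
Definition sort_key C : seqlexi R :=
  edist_set x0 C :: [seq rep C 0 i | i <- enum 'I_n].

Definition distance_order C C' : Prop := (sort_key C < sort_key C')%O.

Lemma distance_order_euclidean : euclidean_order A x0 distance_order.
Proof.
split=> //; first split.
- by move=> C _; rewrite /distance_order ltxx.
- by move=> C C' C'' _ _ _; apply: lt_trans.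
- move=> C C' /(chamberP hA hlf)[c fc ->] /(chamberP hA hlf)[c' fc' ->].
  rewrite /distance_order; case: ltgtP => [h|h|[_ e]]; [by constructor 2|by constructor 3|].
  constructor 1; rewrite -repE -(repE c'); congr face_at.
  apply/rowP => i; move/eq_in_map: e; apply; exact: mem_enum.
- move=> C C' _ _ /ltW; rewrite lexi_cons => /andP[] //.
Qed.

Lemma Sal_rep p : Sal A p -> p = (p.1, face_at (rep p.2)).
Proof. by move=> /(salP hA hlf)[d [f [_ _ ->]]] /=; rewrite repE. Qed.

Lemma face_rep p : Sal A p -> face_at (rep p.2) = p.2.
Proof. by move=> /Sal_rep {2}->. Qed.

Lemma Sal_lt_rep p q : Sal A p -> Sal A q -> Sal_lt A p q ->
  leS (rep q.2) (rep p.2) /\ ~ leS (rep p.2) (rep q.2).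
Proof.
move=> Sp Sq [[n1 n2] _]; split=> [|/face_at_sub]; last by rewrite !face_rep.
by apply/face_at_sub; rewrite !face_rep.
Qed.

Let ord := distance_order.
Let eord : euclidean_order A x0 ord := distance_order_euclidean.
Let eta := eta A ord.
Let fib := fiber A ord.

Lemma fiber_rep p : Sal A p -> fib (eta p) (rep p.2).
Proof. by move=> Sp; exists p.1; rewrite -Sal_rep. Qed.

Lemma euclidean_matching_exists : exists M, euclidean_matching A x0 M.
Proof.
have [phi hphi] : {phi : cell -> V -> seqlexi R & forall u,
    (exists c z, [/\ base A x0 c z, u.1 = face_at c & forall f, fib u f -> eqS f z]) \/
    matching_potential A (@aff R n) (fib u) (phi u)}.
  apply: (@choice _ _ (fun u phi => (exists c z, [/\ base A x0 c z, u.1 = face_at c &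
    forall f, fib u f -> eqS f z]) \/ matching_potential A (@aff R n) (fib u) phi)) => u.
  case: (fiber_dichotomy hA hlf gen eord u) => [h|[phi h]]; last by exists phi; right.
  by exists (fun=> [::]); left.
pose pot p := phi (eta p) (rep p.2).
(* The first component has the smaller face, hence is the cell of larger dimension. *)
pose M : set (cell * cell) := [set pq | [/\ Sal A pq.1, Sal A pq.2, eta pq.1 = eta pq.2,
  pot pq.1 = pot pq.2 & fcover A (@aff R n) (rep pq.1.2) (rep pq.2.2)]].
have eqcell p q : Sal A p -> Sal A q -> eta p = eta q -> eqS (rep p.2) (rep q.2) -> p = q.
  move=> Sp Sq epq /face_at_eq; rewrite !face_rep //.
  case: p q Sp Sq epq => [D F] [D' F'] /= Sp Sq epq e; subst F'; congr pair.
  have eF := face_rep Sp; move: eF Sp Sq epq => /= <-; exact: (fiber_cell hA hlf gen eord).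
have crit p : Sal A p -> (exists c z, [/\ base A x0 c z, (eta p).1 = face_at c &
    forall f, fib (eta p) f -> eqS f z]) \/
    matching_potential A (@aff R n) (fib (eta p)) (phi (eta p)).
  by move=> _; apply: hphi.
(* [fcover] tests all points, not only those of the fiber, so it yields covers in the whole of
   [Sal A]. *)
have ME : M `<=` hasse_edges (Sal A) (Sal_lt A).
  move=> [p q] [/= Sp Sq epq _ [le nle cov]].
  have le2 : p.2 `<=` q.2.
    by rewrite -(face_rep Sp) -(face_rep Sq); apply/face_at_sub.
  split=> //=.
    split; last by apply: (fiber_comp hA hlf gen eord Sq Sp).
    by split=> // h; apply: nle; apply/face_at_sub; rewrite !face_rep.
  move=> [r [Sr qr rp]].
  have [l1 n1] := Sal_lt_rep Sq Sr qr; have [l2 n2] := Sal_lt_rep Sr Sp rp.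
  case: (cov _ l2 l1) => e; [apply: n2|apply: n1]; first exact: same_fle.
  by apply: same_fle; apply: same_sym.
(* Fixing [eta] and [pot] leaves at most two cells, which then form an edge of [M]. *)
have sym_case p q : Sal A p -> Sal A q -> eta p = eta q -> pot p = pot q ->
    [\/ p = q, M (p, q) | M (q, p)].
  move=> Sp Sq epq ppq; case: (crit p Sp) => [[c [z [_ _ h]]]|[_ hpot]].
    constructor 1; apply: eqcell => //; apply: same_trans (h _ (fiber_rep Sp)) _.
    by apply: same_sym; apply: h; rewrite epq; apply: fiber_rep.
  have [g [fg pg cov hg]] := hpot _ (fiber_rep Sp).
  have fq : fib (eta p) (rep q.2) by rewrite epq; apply: fiber_rep.
  case: (hg _ fq); first by rewrite -/(pot p) ppq /pot epq.
    by move=> e; constructor 1; apply: eqcell => //; apply: same_sym.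
  move=> /same_sym e; have re f : eqS f f by move=> H.
  case: cov => h; [constructor 2|constructor 3]; split=> //=.
    exact: fcover_same h.
  exact: fcover_same h.
have Mneq p q : M (p, q) -> ~ eqS (rep p.2) (rep q.2).
  by move=> [_ _ _ _ [_ n1 _]] /= e; apply: n1; apply/same_fle/same_sym.
have partner p q q' : (M (p, q) \/ M (q, p)) -> (M (p, q') \/ M (q', p)) -> q = q'.
  move=> h h'.
  have [Sp Sq epq ppq] : [/\ Sal A p, Sal A q, eta p = eta q & pot p = pot q].
    by case: h => -[].
  have [Sq' epq' ppq'] : [/\ Sal A q', eta p = eta q' & pot p = pot q'].
    by case: h' => -[].
  have nq : ~ eqS (rep q.2) (rep p.2).
    by case: h => /Mneq // n1 /same_sym.
  have nq' : ~ eqS (rep q'.2) (rep p.2).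
    by case: h' => /Mneq // n1 /same_sym.
  case: (crit p Sp) => [[c [z [_ _ hz]]]|[_ hpot]].
    case: nq; apply: same_trans (hz _ _) _; first by rewrite epq; apply: fiber_rep.
    by apply: same_sym; apply: hz; apply: fiber_rep.
  have [g [fg pg cov hg]] := hpot _ (fiber_rep Sp).
  have hq : eqS (rep q.2) g.
    case: (hg (rep q.2)) => //; first by rewrite epq; apply: fiber_rep.
    by rewrite -/(pot p) ppq /pot epq.
  have hq' : eqS (rep q'.2) g.
    case: (hg (rep q'.2)) => //; first by rewrite epq'; apply: fiber_rep.
    by rewrite -/(pot p) ppq' /pot epq'.
  apply: eqcell => //; first by rewrite -epq.
  by apply: same_trans hq _; apply: same_sym.
have Masym p q : M (p, q) -> ~ M (q, p).
  by move=> [_ _ _ _ [l1 n1 _]] [_ _ _ _ [l2 n2 _]].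
have Mmatch : matching (Sal A) (Sal_lt A) M.
  split=> // p [a b] [a' b'] Me Me' [/= ep|/= ep] [/= ep'|/= ep'];
    rewrite -ep in Me *; rewrite -ep' in Me' *.
  - by congr pair; apply: (partner p); left.
  - have e : b = a' by apply: (partner p); [left|right].
    by rewrite e in Me; case: (Masym _ _ Me).
  - have e : a = b' by apply: (partner p); [right|left].
    by rewrite e in Me; case: (Masym _ _ Me).
  - by congr pair; apply: (partner p); right.
exists M; split; first split=> //; last split=> //.
(* Lexicographic comparison: first by [eta], then by the potential inside a common fiber. *)
- pose pre p q := [/\ Sal A p, Sal A q, pair_le A ord (eta p) (eta q) &
    eta p = eta q -> (pot p <= pot q)%O].
  have refl_le p : Sal A p -> pair_le A ord (eta p) (eta p).
    move=> Sp; have [c1 c2] := eta_chambers hA hlf gen eord Sp.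
    by apply: t_step; split=> //; left.
  have anti p q : pair_le A ord (eta p) (eta q) -> pair_le A ord (eta q) (eta p) ->
    eta p = eta q by apply: (pair_le_anti hA hlf eord).
  apply: (acyclic_potential (pre := pre)) => //.
  + move=> p q r [Sp Sq pq h] [_ Sr qr h']; split=> //; first exact: t_trans pq qr.
    move=> e; have epq : eta p = eta q by apply: anti => //; rewrite e.
    by apply: le_trans (h epq) _; apply: h'; rewrite -epq.
  + by move=> p Sp /(Sal_lt_rep Sp Sp)[].
  + move=> p q Sp Sq /(Sal_lt_rep Sp Sq)[l1 n1] /(Sal_lt_rep Sq Sp)[l2 n2].
    exact: n1.
  + move=> p q [Sq Sp qp _]; split=> //; first exact: (eta_lt hA hlf gen eord).
    move=> epq; have [l1 n1] := Sal_lt_rep Sq Sp qp.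
    (* A fiber with a single face contains no strict relation. *)
    case: (crit p Sp) => [[c [z [_ _ hz]]]|[mono _]].
      case: n1; apply: same_fle; apply: same_trans (hz _ _) _.
        by rewrite -epq; apply: fiber_rep.
      by apply: same_sym; apply: hz; apply: fiber_rep.
    rewrite /pot epq; apply: mono => //; first exact: fiber_rep.
    by rewrite -epq; apply: fiber_rep.
  + move=> p q [/= Sp Sq epq ppq _]; split=> //; last by rewrite ppq.
    by rewrite epq; apply: refl_le.
  + move=> p q Sp Sq [_ _ pq h] [_ _ qp h']; have e := anti _ _ pq qp.
    apply: sym_case => //; apply/eqP; rewrite eq_le h //; exact: h'.
- exists ord => //; split; last by move=> p q [].
  split=> [p Sp|p q Sp Sq [<-|]]; first exact: (eta_chambers hA hlf gen eord).
    have [c1 c2] := eta_chambers hA hlf gen eord Sp.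
    by apply: t_step; split=> //; left.
  exact: (eta_lt hA hlf gen eord).
- apply/seteqP; split=> [p [Sp nM]|_ [C /(chamberP hA hlf)[c fc ->] <-]].
    (* A cell whose fiber carries a potential has a partner, so an unmatched cell is alone in its
       fiber and its face is [F_C]. *)
    case: (crit p Sp) => [[c [z [bz pc hz]]]|[mono hpot]].
      have [fc _] := bz; exists (face_at c); first exact: chamber_face_at.
      rewrite (smallest_face_base hA bz).
      have [c' [z' [f [b e]]]] := sal_based hA hlf gen Sp.
      have fz : eqS f z.
        apply: hz; rewrite /fib e /=; exists (face_at (fcomp hA hlf f c')) => //.
        by rewrite -e.
      move: pc; rewrite e /eta (eta_based hA hlf eord b) /= => /face_at_eq cc.
      congr pair; apply/face_at_eq; last exact: same_sym.
      move=> H AH; rewrite sg_comp //; case: eqVneq => [_|f0]; first by rewrite cc.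
      rewrite fz //; apply/esym; apply: (base_sg bz AH) => z0.
      by move/eqP: f0; apply; apply: (same0 (same_sym fz)).
    have [g [[D SD eD] pg cov _]] := hpot _ (fiber_rep Sp).
    have rg : eqS g (rep (face_at g)) by apply/face_at_eq; rewrite repE.
    have fg : fib (eta p) g by exists D.
    have frg : fib (eta p) (rep (face_at g)) by exists D; rewrite repE.
    have pot_g : pot (D, face_at g) = pot p.
      have eD' : eta (D, face_at g) = eta p := eD.
      rewrite /pot eD' /= -pg; apply/eqP; rewrite eq_le.
      by rewrite !mono //; apply: same_fle => //; apply: same_sym.
    have re f : eqS f f by move=> H.
    case: nM; case: cov => cov.
      by exists (p, (D, face_at g)); [split=> //=; exact: fcover_same cov|left].
    by exists ((D, face_at g), p); [split=> //=; exact: fcover_same cov|right].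
  (* The fiber of the cell of [C] and [F_C] has no other face, whereas matched cells have different
     faces. *)
  have [z bz] := base_exists x0 fc; rewrite (smallest_face_base hA bz).
  have [b hz] := fiber_critical hA hlf gen eord bz.
  have ec : face_at (fcomp hA hlf z c) = face_at c.
    apply/face_at_eq => H AH; rewrite sg_comp //; case: eqVneq => // /eqP z0.
    exact: base_sg bz AH z0.
  have Sp := based_sal hA hlf b; have := eta_based hA hlf eord b.
  rewrite ec in Sp *; rewrite -/eta => ep; split=> // -[[q q'] Mq epq].
  have [/= Sq Sq' eq_ _ _] := Mq; apply: (Mneq _ _ Mq).
  have eq1 : eta q = (face_at c, face_at (fopp hA hlf z c)).
    by case: epq => /= e; rewrite -ep e.
  apply: same_trans (hz _ _) (same_sym (hz _ _)).
    by rewrite -eq1; apply: fiber_rep.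
  by rewrite -eq1 eq_; apply: fiber_rep.
Qed.

End EuclideanMatching.

Theorem theorem5p9 (R : realType) (n : nat) (A : set (set 'rV[R]_n))
  (hA : arrangement A) (hlf : locally_finite A)
  (x0 : 'rV[R]_n) (hx0 : generic A x0) :
  (exists M : set ((set 'rV[R]_n * set 'rV[R]_n) * (set 'rV[R]_n * set 'rV[R]_n)),
     euclidean_matching A x0 M) /\
  (forall M : set ((set 'rV[R]_n * set 'rV[R]_n) * (set 'rV[R]_n * set 'rV[R]_n)),
     euclidean_matching A x0 M -> one_critical_cell_per_chamber A x0 M).
Proof.
by split=> [|M [_ [_ _ crit]]] //; exact: euclidean_matching_exists.
Qed.
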